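(* Let $d\ge1$, let $T_1,\dots,T_d$ be commuting invertible measure preserving maps of a probability space $(E,\mathcal{B},\mu)$ and $T^\ell=T_1^{\ell_1}\cdots T_d^{\ell_d}$. Let $(Z_n)$ be a transient aperiodic random walk on $\mathbb{Z}^d$, defined on $(\Omega,\mathbb{P})$, which is not deterministic (i.e. there is no $\ell\in\mathbb{Z}^d$ with $\mathbb{P}(\zeta_0=\ell)=1$). Let $f\in L^2(E,\mu)$ be real valued, not a.e. equal to $0$, with $\sum_{\ell\in\mathbb{Z}^d}|\langle T^\ell f,f\rangle|<\infty$. Then: (i) for $\mathbb{P}$-a.e. $\omega$, the quenched asymptotic variance $\lim_n\frac1n\bigl\|\sum_{k=0}^{n-1}T^{Z_k(\omega)}f\bigr\|_{L^2(\mu)}^2$ exists and is non-zero; (ii) with $F_f(\omega,x)=f(x)$ on $\Omega\times E$, the annealed asymptotic variance $\lim_n\frac1n\bigl\|\sum_{k=0}^{n-1}F_f\circ T_{\zeta_0}^k\bigr\|_{L^2(\mathbb{P}\times\mu)}^2$ is equal to the quenched one, and both are equal to $\|f\|_2^2+2\sum_{k\ge1}\bigl(\sum_{\ell\in\mathbb{Z}^d}\mathbb{P}(Z_k=\ell)\langle T^\ell f,f\rangle\bigr)$; (iii) $F_f$ is not a coboundary in $L^2(\mathbb{P}\times\mu)$ for $T_{\zeta_0}$.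
   Context: $(\zeta_i)_{i\in\mathbb{Z}}$ are the coordinate maps on $\Omega=(\mathbb{Z}^d)^{\mathbb{Z}}$ with product measure $\mathbb{P}=\nu^{\otimes\mathbb{Z}}$, $\theta$ is the shift on $\Omega$, $\zeta_i=\zeta_0\circ\theta^i$, $Z_0=0$, $Z_n=\zeta_0+\dots+\zeta_{n-1}$. Aperiodic means that the support of $\nu$ generates the group $\mathbb{Z}^d$; transient means $\sum_{n\ge1}\mathbb{P}(Z_n=0)<\infty$. $T^\ell f=f\circ T^\ell$. The skew product $T_{\zeta_0}$ on $(\Omega\times E,\mathbb{P}\times\mu)$ is $T_{\zeta_0}(\omega,x)=(\theta\omega,T^{\zeta_0(\omega)}x)$. $F$ is a coboundary in $L^2$ if $F=H-H\circ T_{\zeta_0}$ for some $H\in L^2(\mathbb{P}\times\mu)$. *)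

(* Defs.v *)
From HB Require Import structures.
From mathcomp Require Import all_boot all_order all_algebra.
From mathcomp Require Import all_classical all_reals all_analysis.

Set Implicit Arguments.
Unset Strict Implicit.
Unset Printing Implicit Defensive.

Import Order.TTheory GRing.Theory Num.Theory.
Import numFieldNormedType.Exports.

Local Open Scope classical_set_scope.
Local Open Scope ring_scope.

(* Z^d with its discrete sigma-algebra. The alias keeps the measurable
   structure off the generic matrix type. *)
Definition lattice (d : nat) : Type := 'rV[int]_d.

HB.instance Definition _ d := GRing.Zmodule.on (lattice d).
HB.instance Definition _ d := isPointed.Build (lattice d) 0.
HB.instance Definition _ d := @isMeasurable.Build default_measure_display
  (lattice d) discrete_measurable discrete_measurable0
  discrete_measurableC discrete_measurableU.

Definition cylinders (d : nat) : set (set (int -> lattice d)) :=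
  [set A | exists i (B : set (lattice d)), A = [set w | B (w i)]].
Arguments cylinders : clear implicits.

(* (Z^d)^Z with the product sigma-algebra *)
Notation path_space d := (g_sigma_algebraType (cylinders d)).

(* The cylinder formula determines P, by uniqueness on a generating
   pi-system: this says that P is the power of nu over the index set Z. *)
Definition is_product_measure (R : realType) (d : nat)
    (nu : probability (lattice d) R) (P : probability (path_space d) R) : Prop :=
  forall (J : seq int) (A : int -> set (lattice d)), uniq J ->
    P [set w | forall i, i \in J -> A i (w i)]
      = (\big[*%E/1%E]_(i <- J) nu (A i)).

Definition generated_subgroup (V : zmodType) (S : set V) : set V :=
  smallest [set G : set V | zmod_closed [in G]] S.

Definition support_of (R : realType) (d : nat)
    (nu : probability (lattice d) R) : set (lattice d) :=
  [set l | (0 < nu [set l])%E].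

Definition aperiodic (R : realType) (d : nat)
    (nu : probability (lattice d) R) : Prop :=
  generated_subgroup (support_of nu) = [set: lattice d].

Definition path_shift (d : nat) (w : path_space d) : path_space d :=
  fun i => w (i + 1).

Definition walk (d : nat) (n : nat) (w : path_space d) : lattice d :=
  \sum_(k < n) w k%:Z.

Definition transient (R : realType) (d : nat)
    (P : probability (path_space d) R) : Prop :=
  (\sum_(1 <= n <oo) P [set w | walk n w = 0%R] < +oo)%E.

Definition deterministic (R : realType) (d : nat)
    (P : probability (path_space d) R) : Prop :=
  exists l : lattice d, P [set w : path_space d | w 0 = l] = 1%E.

Record automorphism (dE : measure_display) (E : measurableType dE)
    (R : realType) (mu : {measure set E -> \bar R}) := Automorphism {
  aut_fun :> E -> E;
  aut_inv : E -> E;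
  aut_funK : cancel aut_fun aut_inv;
  aut_invK : cancel aut_inv aut_fun;
  measurable_aut_fun : measurable_fun [set: E] aut_fun;
  measurable_aut_inv : measurable_fun [set: E] aut_inv;
  aut_preserving : forall A, measurable A -> mu (aut_fun @^-1` A) = mu A
}.

Section action.
Context (dE : measure_display) (E : measurableType dE) (R : realType).
Context (mu : {measure set E -> \bar R}).

Definition aut_exp (S : automorphism mu) (m : int) : E -> E :=
  match m with
  | Posz n => iter n S
  | Negz n => iter n.+1 (aut_inv S)
  end.

(* T^l = T_1^l_1 \o ... \o T_d^l_d *)
Definition lattice_action (d : nat) (T : 'I_d -> automorphism mu) (l : lattice d) :
    E -> E :=
  \big[(fun g h : E -> E => g \o h)/idfun]_(i < d) aut_exp (T i) (l 0 i).

(* <T^l f, f> in L^2(mu), for a real-valued f *)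
Definition correlation (d : nat) (T : 'I_d -> automorphism mu) (f : E -> R)
    (l : lattice d) : R :=
  \int[mu]_x (f (lattice_action T l x) * f x).

(* T_{zeta_0} *)
Definition skew_product (d : nat) (T : 'I_d -> automorphism mu)
    (p : path_space d * E) : path_space d * E :=
  (path_shift p.1, lattice_action T (p.1 0) p.2).

End action.

(* The sum of an absolutely summable real family over Z^d; [esum] itself only
   makes sense for nonnegative families. *)
Definition lattice_sum (R : realType) (d : nat) (a : lattice d -> R) : \bar R :=
  (\esum_(l in setT) ((EFin \o a)^\+ l) -
   \esum_(l in setT) ((EFin \o a)^\- l))%E.

(* (1/n) || g_0 + ... + g_{n-1} ||_{L^2(m)}^2 *)
Definition normalized_variance (dX : measure_display) (X : measurableType dX)
    (R : realType) (m : {measure set X -> \bar R}) (g : nat -> X -> R)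
    (n : nat) : \bar R :=
  ((n%:R^-1)%:E * 'N[m]_2%:E[EFin \o (fun x => \sum_(k < n) g k x)%R] ^+ 2)%E.

Definition L2_coboundary (dX : measure_display) (X : measurableType dX)
    (R : realType) (m : {measure set X -> \bar R}) (S : X -> X) (F : X -> R) :
    Prop :=
  exists2 H : X -> R, H \in Lfun m 2%:E &
    F = (fun p => H p - H (S p)) %[ae m].

(* Main.v *)
(** With [a l = <T^l f, f>] both variances are averages of
    [a 0 + 2 \sum_(1 <= k < n - i) a (Z_k o theta^i)] over [i < n].  Transience
    bounds the Green function uniformly, so that the sums of [E |a (x + Z_k)|]
    over [k] are bounded uniformly in [x] and the annealed limit is a Cesaro mean.

    For the quenched limit, the inner sums are squeezed between
    [g_K -+ h_K] o theta^i, where [g_K] is the sum over [k < K] and [h_K] the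
    absolute tail.  A one-sided ergodic theorem suffices: Birkhoff sums of a
    function with negative mean of the nonnegative coordinates are bounded above,
    because the event that they are unbounded is shift invariant, hence trivial,
    and the increments of their running maxima have nonnegative mean.

    If the variance vanished, perturbing the sum by the orthogonal increments
    [t psi (zeta_i) T^(Z_i + q) f] with [psi (zeta_0)] centered and concentrated on two
    points [l], [l'] of the support would make it negative, unless
    [K x = \sum_k E (a (x + Z_k))] has period [p = l - l'].  As
    [K x = a x + E (K (x + zeta_0))], [a] would then have period [p <> 0] too, which is
    impossible for a summable function with [a 0 > 0].  Finally, the variance of
    a coboundary vanishes. *)

Require Import Defs.
From HB Require Import structures.
From mathcomp Require Import all_boot all_order all_algebra.
From mathcomp Require Import all_classical all_reals all_analysis.
From mathcomp Require Import measurable_realfun ring lra zify.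

Set Implicit Arguments.
Unset Strict Implicit.
Unset Printing Implicit Defensive.

Import Order.TTheory GRing.Theory Num.Theory.
Import numFieldNormedType.Exports.

Local Open Scope classical_set_scope.
Local Open Scope ring_scope.

(** * Measure-preserving maps *)

Section preserving.
Context d1 d2 (X : measurableType d1) (Y : measurableType d2) (R : realType).
Implicit Types (m : {measure set X -> \bar R}) (k : {measure set Y -> \bar R}).

Definition preserving m k (g : X -> Y) :=
  measurable_fun [set: X] g /\
  forall A, measurable A -> m (g @^-1` A) = k A.

Lemma preserving_ge0_integral m k g (F : Y -> \bar R) : preserving m k g ->
  measurable_fun [set: Y] F -> (forall y, 0 <= F y)%E ->
  (\int[m]_x F (g x) = \int[k]_y F y)%E.
Proof.
move=> [mg gP] mF F0.
have := ge0_integral_pushforward mg m measurableT mF (fun y _ => F0 y).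
rewrite preimage_setT => <-; apply: eq_measure_integral => A mA _.
exact: gP.
Qed.

Lemma preserving_integrable m k g (F : Y -> \bar R) : preserving m k g ->
  k.-integrable [set: Y] F -> m.-integrable [set: X] (F \o g).
Proof.
move=> mg /integrableP[mF iF]; apply/integrableP; split.
  exact: measurableT_comp mg.1.
rewrite (preserving_ge0_integral (F := fun y => `|F y|)%E mg) //.
exact: measurableT_comp.
Qed.

(** The positive and negative parts are transported separately, so that both sides are [fine] of the
    same difference even when [F] is not integrable. *)
Lemma preserving_Rintegral m k g (F : Y -> R) : preserving m k g ->
  measurable_fun [set: Y] F -> \int[m]_x F (g x) = \int[k]_y F y.
Proof.
move=> mg mF; rewrite /Rintegral; congr fine.
have mE : measurable_fun [set: Y] (EFin \o F) by exact/measurable_EFinP.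
rewrite integralE [RHS]integralE.
rewrite -(preserving_ge0_integral (F := (EFin \o F)^\+%E) mg) //; last first.
  exact: measurable_funepos mE.
rewrite -(preserving_ge0_integral (F := (EFin \o F)^\-%E) mg) //.
  by apply: (f_equal2 (fun a b => a - b)%E); apply: eq_integral => x _; rewrite ?funeposE ?funenegE.
exact: measurable_funeneg mE.
Qed.

Lemma preserving_ae m k g (Q : Y -> Prop) : preserving m k g ->
  {ae k, forall y, Q y} -> {ae m, forall x, Q (g x)}.
Proof.
move=> [mg gP] [N [mN N0 sN]]; exists (g @^-1` N); split.
- by rewrite -[_ @^-1` _]setTI; exact: mg.
- by rewrite gP.
- by move=> x /= /sN.
Qed.

End preserving.

Lemma preserving_comp d1 d2 d3 (X : measurableType d1) (Y : measurableType d2)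
    (Z : measurableType d3) (R : realType) (m : {measure set X -> \bar R})
    (m' : {measure set Y -> \bar R}) (m'' : {measure set Z -> \bar R}) g h :
  preserving m m' g -> preserving m' m'' h -> preserving m m'' (h \o g).
Proof.
move=> [mg gP] [mh hP]; split; first exact: measurableT_comp.
move=> A mA; rewrite comp_preimage gP ?hP //.
by rewrite -[_ @^-1` _]setTI; exact: mh.
Qed.

Lemma preserving_id d1 (X : measurableType d1) (R : realType)
  (m : {measure set X -> \bar R}) : preserving m m idfun.
Proof. by split=> [|A mA]; [exact: measurable_id|rewrite preimage_id]. Qed.

(** * The action of the lattice *)

Section action.
Context dE (E : measurableType dE) (R : realType).
Context (mu : {measure set E -> \bar R}).
Implicit Types S U : automorphism mu.

Lemma aut_fun_preserving S : preserving mu mu S.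
Proof. by split; [exact: measurable_aut_fun|exact: aut_preserving]. Qed.

Lemma aut_inv_preserving S : preserving mu mu (aut_inv S).
Proof.
split; first exact: measurable_aut_inv.
move=> A mA; rewrite -(aut_preserving S); last first.
  by rewrite -[_ @^-1` _]setTI; exact: measurable_aut_inv.
by congr (mu _); apply/seteqP; split => x; rewrite /preimage /= aut_funK.
Qed.

Lemma iter_preserving (g : E -> E) n :
  preserving mu mu g -> preserving mu mu (iter n g).
Proof.
move=> mg; elim: n => [|n IH]; first exact: preserving_id.
exact: preserving_comp IH mg.
Qed.

Lemma aut_exp_preserving S m : preserving mu mu (aut_exp S m).
Proof.
case: m => n; apply: iter_preserving.
  exact: aut_fun_preserving.
exact: aut_inv_preserving.
Qed.

Lemma aut_expS S (m : int) x : aut_exp S (m + 1) x = S (aut_exp S m x).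
Proof.
case: m => [n|[|n]].
- by rewrite (_ : n%:Z + 1 = n.+1%:Z) //; lia.
- by rewrite /= aut_invK.
- by rewrite (_ : Negz n.+1 + 1 = Negz n) /= ?aut_invK //; lia.
Qed.

Lemma aut_expP S (m : int) x : aut_exp S (m - 1) x = aut_inv S (aut_exp S m x).
Proof. by rewrite -{2}(subrK 1 m) aut_expS aut_funK. Qed.

Lemma aut_expD S (m n : int) x :
  aut_exp S (m + n) x = aut_exp S m (aut_exp S n x).
Proof.
elim: m => [|m IH|m IH].
- by rewrite add0r.
- by rewrite (_ : m.+1%:Z + n = (m%:Z + n) + 1) ?aut_expS ?IH //; lia.
- rewrite (_ : - (m.+1%:Z) + n = (- m%:Z + n) - 1) ?aut_expP ?IH; last lia.
  by rewrite (_ : - m.+1%:Z = - m%:Z - 1) ?aut_expP //; lia.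
Qed.

Lemma aut_exp_comm S (g : E -> E) : (forall x, S (g x) = g (S x)) ->
  forall m x, aut_exp S m (g x) = g (aut_exp S m x).
Proof.
move=> Sg; have Sg' x : aut_inv S (g x) = g (aut_inv S x).
  by rewrite -{1}(aut_invK S x) -Sg aut_funK.
case=> n x; rewrite /aut_exp.
  by elim: n => //= n ->.
by elim: n.+1 => //= k ->.
Qed.

Context (d : nat) (T : 'I_d -> automorphism mu).
Hypothesis Tcomm : forall i j x, T i (T j x) = T j (T i x).

Lemma aut_exp_commute i j m n x :
  aut_exp (T i) m (aut_exp (T j) n x) = aut_exp (T j) n (aut_exp (T i) m x).
Proof.
apply: aut_exp_comm => y; apply/esym.
by apply: aut_exp_comm => z; exact: Tcomm.
Qed.

(** The product over an arbitrary sequence of indices, so that induction on the sequence is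
    possible. *)
Let comps (r : seq 'I_d) (l : lattice d) : E -> E :=
  \big[(fun g h : E -> E => g \o h)/idfun]_(i <- r) aut_exp (T i) (l 0 i).

Let comps_comm r l j n x :
  aut_exp (T j) n (comps r l x) = comps r l (aut_exp (T j) n x).
Proof.
rewrite /comps; elim: r => [|i r IH]; first by rewrite !big_nil.
by rewrite !big_cons /= aut_exp_commute IH.
Qed.

(** Induction on the list of indices: the factor [T_i^(m_i)] has to be moved across the remaining
    factors of [T^l], which is where commutation enters. *)
Lemma lattice_actionD (l m : lattice d) x :
  lattice_action T (l + m) x = lattice_action T l (lattice_action T m x).
Proof.
rewrite /lattice_action -!/(comps _ _).
elim: (index_enum _) x => [|i r IH] x; first by rewrite /comps !big_nil.
move: IH; rewrite /comps !big_cons -!/(comps _ _) /= => IH.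
by rewrite mxE aut_expD IH comps_comm.
Qed.

Lemma lattice_action0 x : lattice_action T (0 : lattice d) x = x.
Proof.
rewrite /lattice_action.
by elim: (index_enum _) => [|i r IH]; rewrite ?big_nil ?big_cons //= mxE.
Qed.

Lemma lattice_action_preserving (l : lattice d) :
  preserving mu mu (lattice_action T l).
Proof.
rewrite /lattice_action; elim: (index_enum _) => [|i r IH].
  by rewrite big_nil; exact: preserving_id.
rewrite big_cons; apply: preserving_comp IH _; exact: aut_exp_preserving.
Qed.

End action.

(** * Correlations *)

Section Rintegral_sum.
Context d (X : measurableType d) (R : realType) (m : {measure set X -> \bar R}).

Lemma integrable_sumR (I : Type) (r : seq I) (F : I -> X -> R) :
  (forall i, m.-integrable [set: X] (EFin \o F i)) ->
  m.-integrable [set: X] (EFin \o fun x => \sum_(i <- r) F i x).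
Proof.
move=> iF; elim: r => [|i r IH].
  under [X in _.-integrable _ X]funext => x do rewrite /= big_nil.
  exact: integrable0.
under [X in _.-integrable _ X]funext => x do rewrite /= big_cons EFinD.
exact: integrableD (iF i) IH.
Qed.

Lemma Rintegral_sum (I : Type) (r : seq I) (F : I -> X -> R) :
  (forall i, m.-integrable [set: X] (EFin \o F i)) ->
  \int[m]_x (\sum_(i <- r) F i x) = \sum_(i <- r) \int[m]_x F i x.
Proof.
move=> iF; elim: r => [|i r IH].
  rewrite big_nil; under eq_Rintegral => x _ do rewrite big_nil.
  by rewrite Rintegral_cst ?mul0r.
rewrite big_cons -IH -RintegralD //; last exact: integrable_sumR.
by under eq_Rintegral => x _ do rewrite big_cons.
Qed.

(** Both sides live in [\bar R] and may be infinite; the point is to trade the algebraic square for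
    the real power in terms of which [Lnorm] is defined. *)
Lemma Lnorm2_sqr (g : X -> R) :
  ('N[m]_2%:E[EFin \o g] ^+ 2 = \int[m]_x (g x ^+ 2)%:E)%E.
Proof.
have poweR2 (x : \bar R) : (0 <= x -> x ^+ 2 = x `^ 2)%E.
  case: x => [r||] // r0; last by rewrite poweRyr ?pnatr_eq0 // expe2 mulyy.
  by rewrite poweR_EFin powR_mulrn // EFin_expe.
rewrite poweR2 ?Lnorm_ge0// powR_Lnorm//.
apply: eq_integral => x _.
by rewrite poweR_EFin powR_mulrn// real_normK ?num_real.
Qed.

End Rintegral_sum.

Section correlation.
Context dE (E : measurableType dE) (R : realType).
Context (mu : {measure set E -> \bar R}) (d : nat) (T : 'I_d -> automorphism mu).
Hypothesis Tcomm : forall i j x, T i (T j x) = T j (T i x).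
Context (f : E -> R).
Hypothesis hf : f \in Lfun mu 2%:E.

Local Notation act := (lattice_action T).
Local Notation a := (correlation T f).

Let mf : measurable_fun [set: E] f.
Proof. by move: hf; rewrite inE => /andP[]; rewrite inE /=. Qed.

Lemma measurable_fun_action l : measurable_fun [set: E] (fun x => f (act l x)).
Proof. by apply: measurableT_comp => //; exact: (lattice_action_preserving _ _).1. Qed.

Lemma Lfun_action l : (fun x => f (act l x)) \in Lfun mu 2%:E.
Proof.
have := hf; rewrite !inE => /andP[_]; rewrite inE /= => ff.
apply/andP; split; rewrite inE; first exact: measurable_fun_action.
move: ff; rewrite /= /finite_norm; congr (_ < _)%E.
rewrite unlock /Lnorm.body.
rewrite (preserving_ge0_integral (F := fun y => (`|(EFin \o f) y| `^ 2)%E)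
  (lattice_action_preserving T l)) //.
by apply: (measurableT_comp (measurable_poweR _)); apply: measurableT_comp => //;
  exact/measurable_EFinP.
by move=> y; exact: poweR_ge0.
Qed.

Lemma integrable_action2 l m :
  mu.-integrable [set: E] (EFin \o fun x => f (act l x) * f (act m x)).
Proof.
by apply/Lfun1_integrable; apply: Lfun2_mul_Lfun1; exact: Lfun_action.
Qed.

(** Change of variables by [T^m], which preserves [mu], since [l = (l - m) + m]. *)
Lemma correlationE l m : \int[mu]_x (f (act l x) * f (act m x)) = a (l - m).
Proof.
rewrite /correlation.
rewrite -(preserving_Rintegral (F := fun x => f (act (l - m) x) * f x)
  (lattice_action_preserving T m)); last first.
  by apply: measurable_funM => //; exact: measurable_fun_action.
by apply: eq_Rintegral => x _; rewrite -lattice_actionD // subrK.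
Qed.

Lemma correlationN l : a (- l) = a l.
Proof.
rewrite -sub0r -[in RHS](subr0 l) -!correlationE.
by apply: eq_Rintegral => x _; rewrite mulrC.
Qed.

Section quadratic.
Variables (n : nat) (c : nat -> R) (z : nat -> lattice d).

Let term i j x := c i * c j * (f (act (z i) x) * f (act (z j) x)).

Let sqr_sumE x : (\sum_(i < n) c i * f (act (z i) x)) ^+ 2 =
  \sum_(i < n) \sum_(j < n) term i j x.
Proof.
rewrite expr2 mulr_suml; apply: eq_bigr => i _.
by rewrite mulr_sumr; apply: eq_bigr => j _; rewrite mulrACA.
Qed.

Let integrable_term i j : mu.-integrable [set: E] (EFin \o term i j).
Proof.
exact: (integrableZl measurableT (c i * c j) (integrable_action2 (z i) (z j))).
Qed.

Lemma variance_action :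
  \int[mu]_x ((\sum_(i < n) c i * f (act (z i) x)) ^+ 2) =
  \sum_(i < n) \sum_(j < n) c i * c j * a (z i - z j).
Proof.
under eq_Rintegral => x _ do rewrite sqr_sumE.
rewrite Rintegral_sum; last by move=> i; apply: integrable_sumR => j.
apply: eq_bigr => i _; rewrite Rintegral_sum //; apply: eq_bigr => j _.
by rewrite RintegralZl ?correlationE //; exact: integrable_action2.
Qed.

Lemma integrable_variance_action : mu.-integrable [set: E]
    (EFin \o fun x => (\sum_(i < n) c i * f (act (z i) x)) ^+ 2).
Proof.
rewrite (_ : (fun x => _) = fun x => \sum_(i < n) \sum_(j < n) term i j x).
  by apply: integrable_sumR => i; apply: integrable_sumR => j.
by apply/funext => x; exact: sqr_sumE.
Qed.

End quadratic.

(** Positive definiteness of the correlation function: the form is the squared norm of the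
    combination of the [T^(z i) f] with coefficients [c i]. Arbitrary coefficients are needed for
    the perturbation argument. *)
Lemma variance_action_ge0 n (c : nat -> R) (z : nat -> lattice d) :
  0 <= \sum_(i < n) \sum_(j < n) c i * c j * a (z i - z j).
Proof. by rewrite -variance_action; apply: Rintegral_ge0 => x _; exact: sqr_ge0. Qed.

Lemma Lnorm2_action n (z : nat -> lattice d) :
  ('N[mu]_2%:E[EFin \o fun x => (\sum_(i < n) f (act (z i) x))%R] ^+ 2)%E =
  (\sum_(i < n) \sum_(j < n) a (z i - z j))%:E.
Proof.
have -> : \sum_(i < n) \sum_(j < n) a (z i - z j) =
    \sum_(i < n) \sum_(j < n) cst 1 (i : nat) * cst 1 (j : nat) * a (z i - z j).
  by apply: eq_bigr => i _; apply: eq_bigr => j _; rewrite /= !mul1r.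
rewrite -(variance_action n (cst 1) z) /Rintegral fineK; last first.
  exact: integrable_fin_num (integrable_variance_action _ _ _).
rewrite Lnorm2_sqr; apply: eq_integral => x _; congr (_ ^+ 2)%:E.
by apply: eq_bigr => i _; rewrite mul1r.
Qed.

Lemma Lnorm2_correlation0 : ('N[mu]_2%:E[EFin \o f] ^+ 2 = (a 0)%:E)%E.
Proof.
have := Lnorm2_action 1 (cst 0); rewrite !big_ord1 subrr => <-.
congr (_ ^+ 2)%E; apply: eq_Lnorm => x /=.
by rewrite big_ord1 lattice_action0.
Qed.

Lemma correlation0_gt0 : ~ (f = cst 0 %[ae mu]) -> 0 < a 0.
Proof.
move=> f0; rewrite lt_neqAle; apply/andP; split; last first.
  have := variance_action_ge0 1 (cst 1) (cst 0).
  by rewrite !big_ord1 subrr !mul1r.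
apply/eqP => a0; apply: f0.
have := Lnorm2_correlation0; rewrite -a0.
move=> /eqP; rewrite expe_eq0 /= => /eqP N0.
have /= := @Lnorm_eq0_eq0 _ E R mu (EFin \o f) 2%:E _ _ N0.
have mE : measurable_fun [set: E] (EFin \o f) by exact/measurable_EFinP.
rewrite lte_fin ltr0n => /(_ mE isT).
by apply: filterS => x /= h /h [].
Qed.

End correlation.

(** * Independence of past and future *)

Section paths.
Context (d : nat) (R : realType).
Context (nu : probability (lattice d) R) (P : probability (path_space d) R).
Hypothesis hP : is_product_measure nu P.

Local Notation path := (path_space d).

Definition box (J : seq int) (A : int -> set (lattice d)) : set path :=
  [set w | forall i, i \in J -> A i (w i)].

(** The pi-system on which [is_product_measure] prescribes the values of [P]. *)
Let boxes : set (set path) := [set B | exists J A, uniq J /\ B = box J A].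

Lemma measurable_coord i : measurable_fun [set: path] (fun w : path => w i).
Proof.
move=> _ A _; rewrite setTI; apply: sub_sigma_algebra.
by exists i, A.
Qed.

Lemma measurable_box J A : measurable (box J A).
Proof.
elim: J => [|i J IH].
  by rewrite (_ : box _ _ = setT) //; apply/seteqP; split.
rewrite (_ : box _ _ = [set w | A i (w i)] `&` box J A).
  apply: measurableI => //; rewrite -[X in measurable X]setTI.
  exact: (@measurable_coord i).
apply/seteqP; split => w /=.
  by move=> h; split => [|j jJ]; apply: h; rewrite inE ?eqxx ?jJ ?orbT.
by move=> [h1 h2] j; rewrite inE => /orP[/eqP ->|/h2].
Qed.

Let boxesE : @measurable _ path = <<s boxes >>.
Proof.
apply/seteqP; split.
  apply: smallest_sub; first exact: smallest_sigma_algebra.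
  move=> _ [i [B ->]]; apply: sub_sigma_algebra; exists [:: i], (fun _ => B).
  split => //; apply/seteqP; split => w /= h.
    by move=> j; rewrite inE => /eqP ->.
  by apply: h; rewrite inE.
apply: smallest_sub; first exact: sigma_algebra_measurable.
by move=> _ [J [A [_ ->]]]; exact: measurable_box.
Qed.

Let boxesI : setI_closed boxes.
Proof.
move=> _ _ [J [A [uJ ->]]] [J' [A' [uJ' ->]]].
(* The memberships guard the two constraints, because [A] is arbitrary outside [J] and [A'] outside
   [J']. *)
exists (undup (J ++ J')), (fun i => [set x | (i \in J -> A i x) /\ (i \in J' -> A' i x)]).
split; first exact: undup_uniq.
apply/seteqP; split => w /=.
  by move=> [h h'] i _; split => [/h|/h'].
move=> h; split => i iJ.
  by apply: (h i _).1 => //; rewrite mem_undup mem_cat iJ.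
by apply: (h i _).2 => //; rewrite mem_undup mem_cat iJ orbT.
Qed.

Lemma path_measure_unique (m m' : {measure set path -> \bar R}) :
  (m [set: path] < +oo)%E ->
  (forall J A, uniq J -> m (box J A) = m' (box J A)) ->
  forall B, measurable B -> m B = m' B.
Proof.
move=> moo h; apply: (measure_unique boxes (fun _ => setT)) => //.
- move=> _; exists [::], (fun _ => setT); split => //.
  by apply/seteqP; split.
- by rewrite bigcup_const.
- by move=> _ [J [A [uJ ->]]]; exact: h.
Qed.

Lemma measurable_to_path dX (X : measurableType dX) (g : X -> path) :
  (forall i, measurable_fun [set: X] (fun x => g x i)) ->
  measurable_fun [set: X] g.
Proof.
move=> mg; refine (@measurability _ _ X path setT g (cylinders d) erefl _).
by move=> _ [_ [i [B ->]] <-]; exact: mg.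
Qed.

(** Testing on boxes suffices, by uniqueness on the pi-system. This gives the invariance of [P]
    under the shift and under gluing. *)
Lemma preserving_path dX (X : measurableType dX) (m : {measure set X -> \bar R})
    (g : X -> path) :
  (forall i, measurable_fun [set: X] (fun x => g x i)) ->
  (m [set: X] < +oo)%E ->
  (forall J A, uniq J ->
    m [set x | forall i, i \in J -> A i (g x i)] = \big[*%E/1%E]_(i <- J) nu (A i)) ->
  preserving m P g.
Proof.
move=> mg moo h; have mgT := measurable_to_path mg; split => // B mB.
rewrite -[LHS]/(pushforward m g B).
apply: (@path_measure_unique (pushforward m g)) => //.
by move=> J A uJ; exact: (etrans (h _ _ uJ) (esym (hP A uJ))).
Qed.

Definition shiftn (k : nat) (w : path) : path := fun i => w (i + k%:Z).

(** The first path supplies the past before time [k], the second one everything from [k] on. That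
    this map sends [P \x P] to [P] is the form in which independence of past and future is used. *)
Definition glue (k : nat) (p : path * path) : path :=
  fun i => if i < k%:Z then p.1 i else p.2 i.

Lemma shiftn_preserving k : preserving P P (shiftn k).
Proof.
apply: preserving_path.
- by move=> i; exact: measurable_coord.
- exact: (le_lt_trans (probability_le1 P measurableT) (ltry _)).
move=> J A uJ.
pose J' := [seq i + k%:Z | i <- J]; pose A' i := A (i - k%:Z).
have uJ' : uniq J' by rewrite map_inj_uniq // => i j /addIr.
apply: (@etrans _ _ (P (box J' A'))).
  congr (P _); apply/seteqP; split => w h i.
    by move=> /mapP[j jJ ->]; rewrite /A' addrK; exact: h.
  move=> iJ; have := h (i + k%:Z); rewrite /A' addrK; apply.
  by apply/mapP; exists i.
apply: (etrans (hP A' uJ')); rewrite big_map; apply: eq_bigr => i _.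
by rewrite /A' addrK.
Qed.

(** The preimage of a box is a rectangle, obtained by splitting [J] at [k], and the product formula
    factors accordingly. *)
Lemma glue_preserving k : preserving (P \x P)%E P (glue k).
Proof.
apply: preserving_path.
- move=> i; rewrite /glue; case: (i < k%:Z).
    exact: (measurableT_comp (@measurable_coord i) measurable_fst).
  exact: (measurableT_comp (@measurable_coord i) measurable_snd).
- suff h : ((P \x P)%E [set: path * path] < +oo)%E by exact: h.
  rewrite -setXTT product_measure1E //.
  change (P [set: path] * P [set: path] < +oo)%E.
  by rewrite probability_setT mul1e ltry.
move=> J A uJ.
apply: (@etrans _ _ ((P \x P)%E (box [seq i <- J | i < k%:Z] A `*`
   box [seq i <- J | ~~ (i < k%:Z)] A))).
  congr ((P \x P)%E _); apply/seteqP; split => -[w w'].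
    move=> h; split => i; rewrite mem_filter => /andP[ik iJ];
      have := h i iJ; rewrite /glue; first by rewrite ik.
    by rewrite (negbTE ik).
  move=> [/= h h'] i iJ; rewrite /glue; case: ifPn => ik.
    by apply: h; rewrite mem_filter ik.
  by apply: h'; rewrite mem_filter ik.
rewrite product_measure1E; try exact: measurable_box.
apply: (etrans (f_equal2 (fun x y => x * y)%E (hP A (filter_uniq _ uJ))
  (hP A (filter_uniq _ uJ)))).
by rewrite !big_filter [RHS](bigID (fun i : int => i < k%:Z)).
Qed.

(** Dependence on coordinates is stated pointwise rather than by a sub-sigma-algebra, so that it
    combines directly with [glue]. With [V := Prop] it applies to events. *)
Definition past_of (V : Type) (k : nat) (F : path -> V) :=
  forall w w' : path, (forall i, i < k%:Z -> w i = w' i) -> F w = F w'.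

Definition future_of (V : Type) (F : path -> V) :=
  forall w w' : path, (forall i, 0 <= i -> w i = w' i) -> F w = F w'.

Lemma past_glue (V : Type) k (F : path -> V) p :
  past_of k F -> F (glue k p) = F p.1.
Proof. by apply => i ik; rewrite /glue ik. Qed.

Lemma future_glue (V : Type) k (F : path -> V) p :
  future_of F -> F (shiftn k (glue k p)) = F (shiftn k p.2).
Proof.
apply => i i0; rewrite /shiftn /glue ifF //.
by apply/negbTE; rewrite -leNgt lerDr.
Qed.

(** Pulled back by [glue k], the intersection becomes a rectangle in the product space. *)
Lemma probability_past_future k (A B : set path) :
  measurable A -> measurable B -> past_of k A -> future_of B ->
  P (A `&` shiftn k @^-1` B) = (P A * P B)%E.
Proof.
move=> mA mB pA fB.
have [ms sP] := shiftn_preserving k; have [mg gP] := glue_preserving k.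
have msB : measurable (shiftn k @^-1` B).
  by rewrite -[X in measurable X]setTI; exact: ms.
rewrite -[P B]sP // -product_measure1E // -gP; last exact: measurableI.
congr (_ _); apply/seteqP; split => p /=.
  by rewrite (past_glue _ pA) /preimage /= (future_glue _ _ fB).
by rewrite (past_glue _ pA) /preimage /= (future_glue _ _ fB).
Qed.

Lemma shiftnD k l w : shiftn k (shiftn l w) = shiftn (k + l) w.
Proof. by apply/funext => i; rewrite /shiftn -addrA. Qed.

(** Invariance allows [B] to be pushed beyond any finite set of coordinates, hence [B] is
    independent of every box, then of every event, then of itself, so [P B = (P B)^2]. *)
Lemma zero_one (B : set path) : measurable B -> future_of B ->
  shiftn 1 @^-1` B = B -> P B = 0%E \/ P B = 1%E.
Proof.
move=> mB fB iB.
have iBk k : shiftn k @^-1` B = B.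
  elim: k => [|k IH].
    by apply/funext => w; rewrite /preimage; congr (B _); apply/funext => i;
      rewrite /shiftn addr0.
  rewrite -[RHS]IH -[in RHS]iB; apply/funext => w; rewrite /preimage /=.
  by rewrite shiftnD add1n.
have fPB : P B \is a fin_num by rewrite fin_num_measure.
pose r : {nonneg R} := NngNum (fine_ge0 (measure_ge0 P B)).
(* Independence from [B] is an equality of two finite measures, the restriction of [P] to [B] and
   the multiple of [P] by [P B], so boxes suffice. *)
have indep A : measurable A -> mrestr P mB A = mscale r P A.
  apply: path_measure_unique.
    change (P (setT `&` B) < +oo)%E; rewrite setTI.
    exact: (le_lt_trans (probability_le1 P mB) (ltry _)).
  move=> J A' uJ; change (P (box J A' `&` B) = (fine (P B))%:E * P (box J A'))%E.
  have [k kJ] : exists k : nat, forall i, i \in J -> i < k%:Z.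
    elim: J {uJ} => [|i J [k kJ]]; first by exists 0%N.
    exists (maxn k (`|i|%N).+1) => j; rewrite inE => /orP[/eqP ->|/kJ]; lia.
  rewrite -[in LHS](iBk k) probability_past_future //.
  - by rewrite muleC fineK.
  - exact: measurable_box.
  - move=> w w' ww'; apply/propext; split => h i iJ.
      by rewrite -ww' ?kJ //; exact: h.
    by rewrite ww' ?kJ //; exact: h.
have := indep _ mB; change (P (B `&` B) = (fine (P B))%:E * P B -> P B = 0 \/ P B = 1)%E.
rewrite setIid -(fineK fPB) /= -EFinM => /eqP; rewrite eqe => /eqP h.
have : fine (P B) * (fine (P B) - 1) = 0 by rewrite mulrBr mulr1 -h subrr.
move=> /eqP; rewrite mulf_eq0 subr_eq0 => /orP[] /eqP ->; by [left|right].
Qed.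

End paths.

(** * A one-sided ergodic theorem *)

Section ergodic.
Context (d : nat) (R : realType).
Context (nu : probability (lattice d) R) (P : probability (path_space d) R).
Hypothesis hP : is_product_measure nu P.

Local Notation path := (path_space d).

Lemma measurable_shiftn k : measurable_fun [set: path] (@shiftn d k).
Proof. exact: (shiftn_preserving hP k).1. Qed.

Lemma shiftn0 (w : path) : shiftn 0 w = w.
Proof. by apply/funext => i; rewrite /shiftn addr0. Qed.

Lemma integrable_shiftn k (f : path -> R) :
  P.-integrable [set: path] (EFin \o f) ->
  P.-integrable [set: path] (EFin \o fun w => f (shiftn k w)).
Proof. exact: preserving_integrable (shiftn_preserving hP k). Qed.

(** * Birkhoff sums and their running maxima *)

Section birkhoff.
Variable f : path -> R.
Hypotheses (intf : P.-integrable [set: path] (EFin \o f)) (futf : future_of f).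

Let mf : measurable_fun [set: path] f.
Proof. by move/integrableP : intf => [/measurable_EFinP]. Qed.

Definition birkhoff (n : nat) (w : path) : R := \sum_(i < n) f (shiftn i w).

Lemma measurable_birkhoff n : measurable_fun [set: path] (birkhoff n).
Proof.
apply: measurable_sum => i; apply: measurableT_comp => //.
exact: measurable_shiftn.
Qed.

Lemma birkhoffS n w : birkhoff n.+1 w = f w + birkhoff n (shiftn 1 w).
Proof.
rewrite /birkhoff big_ord_recl shiftn0; congr (_ + _).
by apply: eq_bigr => i _; rewrite shiftnD addn1.
Qed.

Lemma future_shiftn k : future_of (fun w => f (shiftn k w)).
Proof.
by move=> w w' ww'; apply: futf => i i0; apply: ww'; rewrite addr_ge0.
Qed.

(** The bounds [C] are natural numbers, which makes the event a countable intersection of countable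
    unions. *)
Let unbounded : set path :=
  [set w | forall C : nat, exists n, C%:R < birkhoff n w].

Let measurable_unbounded : measurable unbounded.
Proof.
rewrite (_ : unbounded = \bigcap_C \bigcup_n [set w | C%:R < birkhoff n w]).
  apply: bigcapT_measurable => C; apply: bigcupT_measurable => n.
  rewrite -[X in measurable X]setTI.
  exact: (measurable_fun_ltr (measurable_cst _) (measurable_birkhoff n)
    measurableT (Y := [set true])).
apply/seteqP; split => w /=.
  by move=> h C _; have [n ?] := h C; exists n.
by move=> h C; have [n _ ?] := h C I; exists n.
Qed.

Let future_unbounded : future_of unbounded.
Proof.
move=> w w' ww'; apply/propext.
have e n : birkhoff n w = birkhoff n w'.
  by apply: eq_bigr => i _; exact: future_shiftn.
by split => h C; have [n hn] := h C; exists n; rewrite ?e // -e.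
Qed.

Let nat_above (x : R) : exists C : nat, x < C%:R.
Proof.
exists (Num.bound `|x|); apply: le_lt_trans (ler_norm x) _.
exact: archi_boundP.
Qed.

Let unbounded_shift : @shiftn d 1 @^-1` unbounded = unbounded.
Proof.
apply/seteqP; split => w h C.
  have [C' C'P] := nat_above (C%:R - f w).
  have [n hn] := h C'; exists n.+1; rewrite birkhoffS.
  by move: (lt_trans C'P hn); rewrite ltrBlDl.
(* The maximum with 0 rules out the empty sum [n = 0], to which no sum along the shifted path
   corresponds. *)
have [C' C'P] := nat_above (Num.max 0 (C%:R + f w)).
have [[|n] hn] := h C'.
  move: hn C'P; rewrite /birkhoff big_ord0 => h1 h2.
  by move: (lt_trans h2 h1); rewrite gt_max ltxx.
exists n; move: hn; rewrite birkhoffS => hn.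
move: (lt_trans C'P hn); rewrite gt_max => /andP[_].
by rewrite addrC ltrD2l.
Qed.

(** The maximum of [birkhoff n w] over [1 <= n <= N.+1]. The recursive form exhibits
    [maximal N.+1 - maximal N \o shiftn 1] as [f] plus the negative part of
    [maximal N \o shiftn 1]. *)
Fixpoint maximal (N : nat) (w : path) : R :=
  if N is N'.+1 then f w + Num.max 0 (maximal N' (shiftn 1 w)) else f w.

Lemma le_maximal N w : maximal N w <= maximal N.+1 w.
Proof.
elim: N w => [|N IH] w; first by rewrite /= lerDl le_max lexx.
by rewrite [X in _ <= X]/= lerD2l; apply: Order.POrderTheory.le_trans (le_max2 (lexx 0) (IH _)) _.
Qed.

Lemma birkhoff_le_maximal n N w : (n <= N)%N -> birkhoff n.+1 w <= maximal N w.
Proof.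
elim: N n w => [|N IH] n w.
  by rewrite leqn0 => /eqP ->; rewrite /birkhoff big_ord1 shiftn0.
move=> nN; rewrite birkhoffS /= lerD2l le_max; case: n nN => [|n] nN.
  by rewrite /birkhoff big_ord0 lexx.
by rewrite IH // orbT.
Qed.

Let intmaximal N : P.-integrable [set: path] (EFin \o maximal N).
Proof.
elim: N => [|N IH] //=.
have mM : measurable_fun [set: path] (maximal N).
  by move/integrableP : IH => [/measurable_EFinP].
have iM := integrable_shiftn 1 IH.
rewrite (_ : _ \o _ = (EFin \o f) \+
  (EFin \o fun w => Num.max 0 (maximal N (shiftn 1 w)))%R)%E //.
apply: integrableD => //; apply: le_integrable iM => //.
  apply/measurable_EFinP; apply: measurable_maxr => //.
  by apply: measurableT_comp => //; exact: measurable_shiftn.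
move=> w _ /=; rewrite lee_fin; case: (lerP 0 (maximal N (shiftn 1 w))) => h //.
by rewrite normr0.
Qed.

(* If the Birkhoff sums were unbounded almost surely, the maximal functions
   would tend to infinity, so that their increments [maximal N.+1 - maximal N
   \o shiftn 1], of nonnegative integral, would tend to [f]. *)
Lemma birkhoff_bounded : \int[P]_w f w < 0 ->
  {ae P, forall w, exists C : R, forall n, birkhoff n w <= C}.
Proof.
move=> f0.
suff PB : P unbounded = 0%E.
  exists unbounded; split => // w /= h C.
  apply: contrapT => hC; apply: h; exists C%:R => n.
  by rewrite leNgt; apply/negP => h'; apply: hC; exists n.
have [//|PB] := zero_one hP measurable_unbounded future_unbounded unbounded_shift.
exfalso; move: f0; rewrite ltNge => /negP; apply.
pose D N w := maximal N.+1 w - maximal N (shiftn 1 w).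
have intD N : P.-integrable [set: path] (EFin \o D N).
  rewrite (_ : _ \o _ = (EFin \o maximal N.+1) \-
    (EFin \o fun w => maximal N (shiftn 1 w)))%E //.
  by apply: integrableB => //; exact: integrable_shiftn.
(* By shift invariance this is the integral of [maximal N.+1 - maximal N], which is nonnegative
   pointwise. *)
have D0 N : 0 <= \int[P]_w D N w.
  rewrite /D RintegralB //; last exact: integrable_shiftn.
  rewrite (preserving_Rintegral (shiftn_preserving hP 1) (F := maximal N)); last first.
    by have := measurable_int P (intmaximal N); move/measurable_EFinP.
  rewrite subr_ge0; apply: le_Rintegral => //; try exact: intmaximal.
  by move=> w _; exact: le_maximal.
have DE N w : D N w = f w + Num.max (- maximal N (shiftn 1 w)) 0.
  rewrite /D /= -addrA; congr (_ + _).
  by rewrite addr_maxl sub0r subrr.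
have aeB : {ae P, forall w, unbounded w}.
  exists (~` unbounded); split => //; first exact: measurableC.
  by rewrite probability_setC // PB subee.
have Dcvg : {ae P, forall w, [set: path] w -> (fun N => (D N w)%:E) @ \oo --> (f w)%:E}.
  apply: filterS aeB => w; rewrite -unbounded_shift /preimage /= => h _.
  (* Once [maximal N] is positive at the shifted path, its negative part vanishes there, so [D N w]
     is eventually equal to [f w]. *)
  apply: cvg_near_cst; have [[|n] hn] := h 0%N.
    by move: hn; rewrite /birkhoff big_ord0 ltxx.
  exists n => // N /= nN; congr EFin; rewrite DE -[RHS]addr0; congr (_ + _).
  apply/max_idPr; rewrite oppr_le0; apply: (le_trans (ltW hn)).
  exact: birkhoff_le_maximal.
have Dle : {ae P, forall w, forall N, [set: path] w ->
    (`|(D N w)%:E| <= (`|f w| + `|f (shiftn 1 w)|)%:E)%E}.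
  apply/aeW => w N _; rewrite abse_EFin lee_fin DE.
  apply: (le_trans (ler_normD _ _)); rewrite lerD2l.
  (* This bounds the negative part of [maximal N \o shiftn 1] by the absolute value of
     [f \o shiftn 1], uniformly in [N]. *)
  have fM : f (shiftn 1 w) <= maximal N (shiftn 1 w).
    have := birkhoff_le_maximal (shiftn 1 w) (leq0n N).
    by rewrite /birkhoff big_ord1 shiftn0.
  rewrite ger0_norm; last by rewrite le_max lexx orbT.
  rewrite ge_max normr_ge0 andbT.
  by rewrite -normrN; apply: le_trans (ler_norm _); rewrite lerN2.
have intg : P.-integrable [set: path]
    (EFin \o fun w => `|f w| + `|f (shiftn 1 w)|).
  rewrite (_ : _ \o _ = (fun w => `|(EFin \o f) w|%E) \+
    (fun w => `|(EFin \o fun w => f (shiftn 1 w)) w|))%E //.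
  by apply: integrableD => //; apply: integrable_abse => //; exact: integrable_shiftn.
have mDE N : measurable_fun [set: path] (EFin \o D N).
  exact: (measurable_int P (intD N)).
have mfE : measurable_fun [set: path] (EFin \o f) by exact/measurable_EFinP.
have [_ _ cD] := dominated_convergence measurableT mDE mfE Dcvg intg Dle.
apply: fine_ge0; rewrite -(cvg_lim _ cD) //.
apply: lime_ge; first by apply/cvg_ex; eexists; exact: cD.
apply: nearW => N; rewrite -[X in (_ <= X)%E]fineK ?lee_fin; first exact: D0.
exact: (integrable_fin_num measurableT (intD N)).
Qed.

End birkhoff.

(** The previous lemma applied to [g - c], whose mean is negative. *)
Lemma birkhoff_upper (g : path -> R) (c : R) :
  P.-integrable [set: path] (EFin \o g) -> future_of g -> \int[P]_w g w < c ->
  {ae P, forall w, exists C : R, forall n, birkhoff g n w <= n%:R * c + C}.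
Proof.
move=> intg futg gc.
have intc : P.-integrable [set: path] (EFin \o cst c).
  by apply: finite_measure_integrable_cst.
have : {ae P, forall w, exists C : R, forall n, birkhoff (fun w => g w - c) n w <= C}.
  apply: birkhoff_bounded.
  - exact: (integrableB measurableT intg intc).
  - by move=> w w' ww'; rewrite (futg w w').
  - rewrite RintegralB // Rintegral_cst //.
    rewrite [fine _](_ : _ = 1) ?mulr1 ?subr_lt0 //.
    exact: (congr1 fine (probability_setT P)).
apply: filterS => w [C hC]; exists C => n.
rewrite -lerBlDl; apply: le_trans (hC n).
by rewrite /birkhoff big_split /= sumr_const card_ord mulrC mulr_natr mulNrn.
Qed.

End ergodic.

(** * Functions of a lattice-valued random variable *)

Section discrete.
Context (d : nat) dX (X : measurableType dX) (R : realType).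
Context (m : {measure set X -> \bar R}).
Implicit Types z : X -> lattice d.

Let code (l : lattice d) : nat := pickle (l : 'rV[int]_d).

Let code_inj : injective code.
Proof. by move=> l l' /(pcan_inj pickleK). Qed.

Lemma measurable_lattice_fun dY (Y : measurableType dY) (g : lattice d -> Y) :
  measurable_fun [set: lattice d] g.
Proof. by []. Qed.

Let measurable_fiber z l : measurable_fun [set: X] z -> measurable (z @^-1` [set l]).
Proof. by move=> mz; rewrite -[X in measurable X]setTI; exact: mz. Qed.

(** The fibres of [z] form a countable measurable partition, and on each of them the function is one
    of the [F l]. *)
Lemma measurable_lattice_case dY (Y : measurableType dY) z (F : lattice d -> X -> Y) :
  measurable_fun [set: X] z -> (forall l, measurable_fun [set: X] (F l)) ->
  measurable_fun [set: X] (fun x => F (z x) x).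
Proof.
move=> mz mF _ A mA; rewrite setTI.
rewrite (_ : _ @^-1` A = \bigcup_l (z @^-1` [set l] `&` F l @^-1` A)); last first.
  apply/seteqP; split => x /=; first by move=> ?; exists (z x).
  by move=> [l _ [/= <-]].
apply: countable_bigcupT_measurable => [|l].
  by apply/pcard_injP; exists code => a b _ _; exact: code_inj.
apply: measurableI; first exact: measurable_fiber.
by rewrite -[X in measurable X]setTI; exact: mF.
Qed.

Lemma measurable_latticeD z z' : measurable_fun [set: X] z ->
  measurable_fun [set: X] z' -> measurable_fun [set: X] (fun x => z x + z' x).
Proof.
move=> mz mz'; apply: (measurable_lattice_case (F := fun l x => l + z' x)) => // l.
exact: (measurableT_comp (measurable_lattice_fun (fun y => l + y))).
Qed.

Lemma measurable_lattice_sum (I : Type) (r : seq I) (z : I -> X -> lattice d) :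
  (forall i, measurable_fun [set: X] (z i)) ->
  measurable_fun [set: X] (fun x => \sum_(i <- r) z i x).
Proof.
move=> mz; elim: r => [|i r IH].
  by under eq_fun do rewrite big_nil; exact: measurable_cst.
by under eq_fun do rewrite big_cons; exact: measurable_latticeD.
Qed.

(** Transfer to the law of [z]. The lattice is cut into the level sets of [code], each empty or a
    single point, so that the sum over the lattice becomes a series over [nat]. *)
Lemma integral_lattice z (g : lattice d -> \bar R) :
  measurable_fun [set: X] z -> (forall l, 0 <= g l)%E ->
  (\int[m]_x g (z x) = \esum_(l in [set: lattice d]) (g l * m [set x | z x = l]))%E.
Proof.
move=> mz g0; pose J n := [set l : lattice d | code l = n].
have JT : \bigcup_n J n = [set: lattice d].
  by apply/seteqP; split => // l _; exists (code l).
have tJ : trivIset [set: nat] J.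
  by move=> i j _ _ [l [/= <- <-]].
have h0 l : (0 <= g l * m [set x | z x = l])%E by rewrite mule_ge0.
rewrite -JT (nneseries_sum_bigcup tJ h0).
pose F n := z @^-1` J n.
have mF n : measurable (F n) by rewrite -[X in measurable X]setTI; exact: mz.
have FT : \bigcup_n F n = [set: X] by rewrite -preimage_bigcup JT preimage_setT.
rewrite -FT (@ge0_integral_bigcup _ _ _ m F (fun x => g (z x))) //; last 2 first.
- by rewrite FT; apply: (measurableT_comp (measurable_lattice_fun g)).
- by move=> i j _ _ [x [/= <- <-]].
apply: eq_eseriesr => n _.
have [[l Jl]|Jn] := pselect (exists l, J n l).
  have JE : J n = [set l].
    by apply/seteqP; split => [l' /= Jl'|l' -> //]; apply: code_inj; rewrite Jl Jl'.
  rewrite JE esum_set1 // /F JE.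
  transitivity (\int[m]_(x in z @^-1` [set l]) (cst (g l) x))%E.
    by apply: eq_integral => x; rewrite inE /= => ->.
  by rewrite integral_cst //; exact: measurable_fiber.
have JE : J n = set0 by apply/seteqP; split => // l Jl; apply: Jn; exists l.
by rewrite JE esum_set0 /F JE preimage_set0 integral_set0.
Qed.

End discrete.

(** * Bounded random variables *)

Section bounded.
Context dX (X : measurableType dX) (R : realType).

(** Functions of the walk through a bounded function on the lattice are of this kind. The class is
    stable under sums and products and consists of integrable functions, which keeps the
    computations of expectations below short. *)
Definition bounded_rv (F : X -> R) :=
  measurable_fun [set: X] F /\ exists C : R, forall x, `|F x| <= C.

Lemma bounded_rv_cst c : bounded_rv (fun=> c).
Proof. by split; [exact: measurable_cst|exists `|c|]. Qed.

Lemma bounded_rvD F G : bounded_rv F -> bounded_rv G ->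
  bounded_rv (fun x => F x + G x).
Proof.
move=> [mF [C hC]] [mG [C' hC']]; split; first exact: measurable_funD.
by exists (C + C') => x; apply: le_trans (ler_normD _ _) (lerD _ _).
Qed.

Lemma bounded_rvM F G : bounded_rv F -> bounded_rv G ->
  bounded_rv (fun x => F x * G x).
Proof.
move=> [mF [C hC]] [mG [C' hC']]; split; first exact: measurable_funM.
by exists (C * C') => x; rewrite normrM ler_pM.
Qed.

Lemma bounded_rvZ c F : bounded_rv F -> bounded_rv (fun x => c * F x).
Proof. by move=> bF; apply: bounded_rvM => //; exact: bounded_rv_cst. Qed.

Lemma bounded_rvB F G : bounded_rv F -> bounded_rv G ->
  bounded_rv (fun x => F x - G x).
Proof.
move=> bF bG; under eq_fun do rewrite -mulN1r.
by apply: bounded_rvD => //; exact: bounded_rvZ.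
Qed.

Lemma bounded_rv_norm F : bounded_rv F -> bounded_rv (fun x => `|F x|).
Proof.
move=> [mF [C hC]]; split; first exact: measurableT_comp.
by exists C => x; rewrite normr_id.
Qed.

Lemma bounded_rv_sum (I : Type) (r : seq I) (F : I -> X -> R) :
  (forall i, bounded_rv (F i)) -> bounded_rv (fun x => \sum_(i <- r) F i x).
Proof.
move=> bF; elim: r => [|i r IH].
  by under eq_fun do rewrite big_nil; exact: bounded_rv_cst.
by under eq_fun do rewrite big_cons; exact: bounded_rvD.
Qed.

Lemma bounded_rv_comp dY (Y : measurableType dY) (F : Y -> R) (g : X -> Y) :
  measurable_fun [set: Y] F -> (exists C : R, forall x, `|F x| <= C) ->
  measurable_fun [set: X] g -> bounded_rv (fun x => F (g x)).
Proof.
by move=> mF [C hC] mg; split; [exact: measurableT_comp|exists C => x].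
Qed.

Lemma bounded_rv_integrable (m : {measure set X -> \bar R}) F :
  (m [set: X] < +oo)%E -> bounded_rv F -> m.-integrable [set: X] (EFin \o F).
Proof.
move=> moo [mF [C hC]].
apply: (@le_integrable _ _ _ m _ measurableT _ (EFin \o cst C)).
- exact/measurable_EFinP.
- by move=> x _ /=; rewrite lee_fin; exact: le_trans (hC x) (ler_norm _).
- apply/integrableP; split; first exact/measurable_EFinP/measurable_cst.
  by rewrite /= integral_cst // lte_mul_pinfty.
Qed.

End bounded.

(** * Expectations of bounded random variables *)

Section expectation.
Context dX (X : measurableType dX) (R : realType) (P : probability X R).
Implicit Types F G : X -> R.

Lemma bounded_rv_integrableP F : bounded_rv F -> P.-integrable [set: X] (EFin \o F).
Proof.
apply: bounded_rv_integrable.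
exact: (le_lt_trans (probability_le1 P measurableT) (ltry _)).
Qed.

Lemma expectation_cst c : \int[P]_w c = c.
Proof.
rewrite Rintegral_cst // [fine _](_ : _ = 1) ?mulr1 //.
exact: (congr1 fine (probability_setT P)).
Qed.

Lemma expectationD F G : bounded_rv F -> bounded_rv G ->
  \int[P]_w (F w + G w) = \int[P]_w F w + \int[P]_w G w.
Proof. by move=> bF bG; rewrite RintegralD //; exact: bounded_rv_integrableP. Qed.

Lemma expectationB F G : bounded_rv F -> bounded_rv G ->
  \int[P]_w (F w - G w) = \int[P]_w F w - \int[P]_w G w.
Proof. by move=> bF bG; rewrite RintegralB //; exact: bounded_rv_integrableP. Qed.

Lemma expectationZ c F : bounded_rv F ->
  \int[P]_w (c * F w) = c * \int[P]_w F w.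
Proof. by move=> bF; rewrite RintegralZl //; exact: bounded_rv_integrableP. Qed.

Lemma expectation_sum (I : Type) (r : seq I) (F : I -> X -> R) :
  (forall i, bounded_rv (F i)) ->
  \int[P]_w (\sum_(i <- r) F i w) = \sum_(i <- r) \int[P]_w F i w.
Proof. by move=> bF; apply: Rintegral_sum => i; exact: bounded_rv_integrableP. Qed.

Lemma le_expectation F G : bounded_rv F -> bounded_rv G ->
  (forall w, F w <= G w) -> \int[P]_w F w <= \int[P]_w G w.
Proof.
move=> bF bG FG; apply: le_Rintegral => //; exact: bounded_rv_integrableP.
Qed.

Lemma le_norm_expectation F : bounded_rv F ->
  `|\int[P]_w F w| <= \int[P]_w `|F w|.
Proof.
by move=> bF; apply: le_normr_Rintegral => //; exact: bounded_rv_integrableP.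
Qed.

End expectation.

(** * The random walk *)

Section walk.
Context (d : nat) (R : realType).
Context (nu : probability (lattice d) R) (P : probability (path_space d) R).
Hypothesis hP : is_product_measure nu P.

Local Notation path := (path_space d).
Implicit Types phi : lattice d -> R.

Lemma measurable_walk k : measurable_fun [set: path] (@walk d k).
Proof. by apply: measurable_lattice_sum => i; exact: measurable_coord. Qed.

Lemma walk0 (w : path) : walk 0 w = 0.
Proof. by rewrite /walk big_ord0. Qed.

Lemma walkD j k (w : path) : walk (j + k) w = walk j w + walk k (shiftn j w).
Proof.
rewrite /walk big_split_ord /=; congr (_ + _); apply: eq_bigr => i _.
by rewrite /shiftn PoszD addrC.
Qed.

Lemma walk_past k : past_of k (@walk d k).
Proof. by move=> w w' ww'; apply: eq_bigr => i _; apply: ww'; rewrite ltz_nat. Qed.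

Lemma walk_future k : future_of (@walk d k).
Proof. by move=> w w' ww'; apply: eq_bigr => i _; apply: ww'. Qed.

(** Independence as a Fubini formula: after transport by [glue k] the two arguments of [Phi] depend
    on different factors of [P \x P], and the shift in the second one disappears by invariance. *)
Lemma expectation_past_future k (Phi : path * path -> R) : bounded_rv Phi ->
  (forall w', past_of k (fun w => Phi (w, w'))) ->
  (forall w, future_of (fun w' => Phi (w, w'))) ->
  \int[P]_w Phi (w, shiftn k w) = \int[P]_w \int[P]_w' Phi (w, w').
Proof.
move=> [mPhi [C hC]] pPhi fPhi.
have ms := measurable_shiftn hP k.
have m1 : measurable_fun [set: path] (fun w => Phi (w, shiftn k w)).
  by apply: measurableT_comp => //; exact: measurable_fun_pair.
rewrite -(preserving_Rintegral (glue_preserving hP k) m1).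
have gE p : Phi (glue k p, shiftn k (glue k p)) = Phi (p.1, shiftn k p.2).
  rewrite (past_glue (F := fun w => Phi (w, _)) p (pPhi _)).
  by rewrite (future_glue (F := fun w => Phi (p.1, w)) k p (fPhi _)).
under eq_Rintegral => p _ do rewrite gE.
have b2 : bounded_rv (fun p : path * path => Phi (p.1, shiftn k p.2)).
  apply: (bounded_rv_comp (g := fun p : path * path => (p.1, shiftn k p.2))) => //.
    by exists C => x.
  by apply: measurable_fun_pair => //; exact: measurableT_comp.
have i2 : (P \x P)%E.-integrable [set: path * path]
    (EFin \o fun p => Phi (p.1, shiftn k p.2)).
  suff h : ((P \x P)%E [set: path * path] < +oo)%E.
    exact: (@bounded_rv_integrable _ _ _ (P \x P)%E _ h b2).
  rewrite -setXTT product_measure1E //.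
  change (P [set: path] * P [set: path] < +oo)%E.
  by rewrite probability_setT mul1e ltry.
rewrite {1}/Rintegral -(integral12_prod_meas1 i2); congr fine.
apply: eq_integral => w _; rewrite /fubini_F /=.
have b3 : bounded_rv (fun w' => Phi (w, w')).
  split; last by exists C => x.
  exact: (measurableT_comp mPhi (pair1_measurable w)).
rewrite -(preserving_Rintegral (shiftn_preserving hP k) b3.1).
rewrite /Rintegral fineK //; apply: integrable_fin_num => //.
exact: (integrable_shiftn hP k (bounded_rv_integrableP P b3)).
Qed.

Definition bounded_on_lattice phi := exists C : R, forall l, `|phi l| <= C.

Lemma bounded_rv_lattice dX (X : measurableType dX) phi (z : X -> lattice d) :
  bounded_on_lattice phi -> measurable_fun [set: X] z ->
  bounded_rv (fun x => phi (z x)).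
Proof. by move=> bphi mz; apply: bounded_rv_comp. Qed.

(** The [k]-th power of the transition operator of the walk, applied to [phi]. *)
Definition ker phi k x : R := \int[P]_w phi (x + walk k w).

Lemma bounded_rv_ker phi k x : bounded_on_lattice phi ->
  bounded_rv (fun w : path => phi (x + walk k w)).
Proof.
move=> bphi; apply: bounded_rv_lattice => //.
by apply: measurable_latticeD => //; exact: measurable_walk.
Qed.

Lemma ker_bounded phi C k x : (forall l, `|phi l| <= C) -> `|ker phi k x| <= C.
Proof.
move=> hC; have bphi : bounded_on_lattice phi by exists C.
apply: (le_trans (le_norm_expectation P (bounded_rv_ker k x bphi))).
rewrite -[X in _ <= X](expectation_cst P C); apply: le_expectation => //.
- exact/bounded_rv_norm/bounded_rv_ker.
- exact: bounded_rv_cst.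
Qed.

Lemma ker0 phi x : ker phi 0 x = phi x.
Proof.
rewrite /ker -[RHS](expectation_cst P); apply: eq_Rintegral => w _.
by rewrite walk0 addr0.
Qed.

Lemma expectation_walk_shift phi k x j : bounded_on_lattice phi ->
  \int[P]_w phi (x + walk k (shiftn j w)) = ker phi k x.
Proof.
move=> bphi; apply: (preserving_Rintegral (shiftn_preserving hP j)).
exact: (bounded_rv_ker k x bphi).1.
Qed.

(** The Markov property at time [j], with a weight [F] and a starting point [z] determined by the
    past. *)
Lemma expectation_walk phi k j (F : path -> R) (z : path -> lattice d) :
  bounded_on_lattice phi -> bounded_rv F -> measurable_fun [set: path] z ->
  past_of j F -> past_of j z ->
  \int[P]_w (F w * phi (z w + walk k (shiftn j w))) =
  \int[P]_w (F w * ker phi k (z w)).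
Proof.
move=> bphi bF mz pF pz.
pose Phi (p : path * path) := F p.1 * phi (z p.1 + walk k p.2).
rewrite (expectation_past_future (k := j) (Phi := Phi)).
- apply: eq_Rintegral => w _; rewrite /Phi /= expectationZ //.
  exact: bounded_rv_ker.
- apply: bounded_rvM.
    by apply: bounded_rv_comp measurable_fst; [exact: bF.1|exact: bF.2].
  apply: bounded_rv_lattice => //; apply: measurable_latticeD.
    exact: measurableT_comp mz measurable_fst.
  exact: measurableT_comp (measurable_walk k) measurable_snd.
- by move=> w' w1 w2 h; rewrite /Phi /= (pF _ _ h) (pz _ _ h).
- by move=> w w1 w2 h; rewrite /Phi /= (walk_future k h).
Qed.

Lemma expectation_past_shift k (F G : path -> R) : bounded_rv F -> bounded_rv G ->
  past_of k F -> future_of G ->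
  \int[P]_w (F w * G (shiftn k w)) = (\int[P]_w F w) * \int[P]_w G w.
Proof.
move=> bF bG pF fG; pose Phi (p : path * path) := F p.1 * G p.2.
rewrite (expectation_past_future (k := k) (Phi := Phi)).
- rewrite [RHS]mulrC -expectationZ //; apply: eq_Rintegral => w _.
  by rewrite /Phi /= expectationZ // mulrC.
- apply: bounded_rvM.
    by apply: bounded_rv_comp measurable_fst; [exact: bF.1|exact: bF.2].
  by apply: bounded_rv_comp measurable_snd; [exact: bG.1|exact: bG.2].
- by move=> w' w1 w2 h; rewrite /Phi /= (pF _ _ h).
- by move=> w w1 w2 h; rewrite /Phi /= (fG _ _ h).
Qed.

Lemma kerS phi k x : bounded_on_lattice phi ->
  ker phi k.+1 x = \int[P]_w ker phi k (x + w 0).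
Proof.
move=> bphi.
have := @expectation_walk phi k 1 (fun=> 1) (fun w => x + w 0) bphi
  (bounded_rv_cst _ 1) _ _ _.
rewrite /ker => h; transitivity (\int[P]_w (1 * phi (x + w 0 + walk k (shiftn 1 w)))).
  apply: eq_Rintegral => w _; rewrite mul1r -addn1 addnC walkD addrA.
  by rewrite {1}/walk big_ord1.
rewrite h; first by apply: eq_Rintegral => w _; rewrite mul1r.
- by apply: measurable_latticeD => //; exact: measurable_coord.
- by [].
- by move=> w w' ww'; rewrite ww'.
Qed.

End walk.

(** * Transience *)

(** Off-diagonal pairs are indexed by their smaller index [i] and their gap [k]: stationarity will
    make the terms of gap [k] independent of [i] in mean. *)
Lemma sum_square (V : zmodType) (b : nat -> nat -> V) n :
  \sum_(i < n) \sum_(j < n) b i j =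
  \sum_(i < n) (b i i + \sum_(1 <= k < n - i) (b i (i + k)%N + b (i + k)%N i)).
Proof.
elim: n => [|n IH]; first by rewrite !big_ord0.
rewrite big_ord_recr [RHS]big_ord_recr /=.
rewrite subSn // subnn big_geq // addr0.
under eq_bigr => i _ do rewrite big_ord_recr /=.
rewrite big_split /= IH big_ord_recr /= -!addrA [X in _ = X + _](_ : _ =
    \sum_(i < n) (b i i + \sum_(1 <= k < n - i) (b i (i + k)%N + b (i + k)%N i))
    + \sum_(i < n) (b i n + b n i)).
  by rewrite -!addrA; congr (_ + _); rewrite big_split /= -!addrA.
rewrite -big_split; apply: eq_bigr => i _ /=; rewrite -addrA; congr (_ + _).
have ni : (0 < n - i)%N by rewrite subn_gt0.
by rewrite subSn ?(ltnW (ltn_ord i)) // big_nat_recr //= subnKC // ltnW.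
Qed.

Section green.
Context (d : nat) (R : realType).
Context (nu : probability (lattice d) R) (P : probability (path_space d) R).
Hypothesis hP : is_product_measure nu P.

Local Notation path := (path_space d).
Implicit Types phi : lattice d -> R.

Definition delta (l : lattice d) : lattice d -> R := fun x => (x == l)%:R.

Lemma delta_bounded l : bounded_on_lattice (delta l).
Proof. by exists 1 => x; rewrite /delta; case: eqP => _; rewrite ?normr1 ?normr0. Qed.

Lemma measurable_eq_lattice dX (X : measurableType dX) (z : X -> lattice d) l :
  measurable_fun [set: X] z -> measurable [set x | z x = l].
Proof.
move=> mz; rewrite -[X in measurable X]setTI.
exact: (mz measurableT [set l]).
Qed.

Lemma expectation_delta (z : path -> lattice d) l :
  measurable_fun [set: path] z ->
  \int[P]_w delta l (z w) = fine (P [set w | z w = l]).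
Proof.
move=> mz; have mA := measurable_eq_lattice l mz.
rewrite /Rintegral; congr fine.
transitivity (\int[P]_w (\1_[set w | z w = l] w)%:E)%E.
  apply: eq_integral => w _; congr EFin; rewrite /delta indicE; congr (_%:R).
  by case: eqP => h; [rewrite mem_set|rewrite memNset].
by rewrite integral_indic // setIT.
Qed.

Lemma ker_delta k l : ker P (delta l) k 0 = fine (P [set w | walk k w = l]).
Proof.
rewrite -expectation_delta; last exact: measurable_walk.
by apply: eq_Rintegral => w _; rewrite add0r.
Qed.

Lemma ker_delta_ge0 k l : 0 <= ker P (delta l) k 0.
Proof. by rewrite ker_delta fine_ge0. Qed.

Section transient.
Hypothesis htransient : transient P.

(** Time 0 contributes 1, and the series in [transient] bounds all later returns. *)
Lemma green0 : exists2 G : R, 0 < G & forall n,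
  \sum_(k < n) ker P (delta 0) k 0 <= G.
Proof.
pose S := (\sum_(1 <= n <oo) P [set w | walk n w = 0%R])%E.
have S0 : (0 <= S)%E by apply: nneseries_ge0 => n _ _.
have fS : S \is a fin_num by rewrite ge0_fin_numE.
have fS0 : 0 <= fine S by exact: fine_ge0.
exists (1 + fine S); first by rewrite ltr_pwDl.
case=> [|n]; first by rewrite big_ord0 addr_ge0.
rewrite big_ord_recl ker0 // /delta eqxx lerD2l.
rewrite -lee_fin fineK // /S -sumEFin.
rewrite (_ : \sum_(i < n) _ = \sum_(1 <= k < n.+1) P [set w | walk k w = 0%R])%E.
  by apply: nneseries_lim_ge => k _ _.
rewrite big_add1 /= big_mkord; apply: eq_bigr => i _.
rewrite ker_delta fineK // fin_num_measure //; apply: measurable_eq_lattice.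
exact: measurable_walk.
Qed.

(* The number [N] of visits to [l] before time [n] satisfies
   [(E N)^2 <= E N^2 <= 2 G (E N)] by the Markov property. *)
Lemma green : exists2 G : R, 0 < G & forall n l,
  \sum_(k < n) ker P (delta l) k 0 <= G.
Proof.
have [G G0 hG] := green0; exists (2 * G); first by rewrite mulr_gt0.
move=> n l; pose N (w : path) : R := \sum_(k < n) delta l (walk k w).
have bdelta k : bounded_rv (fun w : path => delta l (walk k w)).
  by apply: bounded_rv_lattice; [exact: delta_bounded|exact: measurable_walk].
have bN : bounded_rv N by exact: bounded_rv_sum.
set EN := \sum_(k < n) _.
have ENE : EN = \int[P]_w N w.
  rewrite expectation_sum //; apply: eq_bigr => k _.
  by apply: eq_Rintegral => w _; rewrite add0r.
have EN0 : 0 <= EN by apply: sumr_ge0 => k _; exact: ker_delta_ge0.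
have jensen : EN ^+ 2 <= \int[P]_w (N w * N w).
  have : 0 <= \int[P]_w ((N w - EN) * (N w - EN)).
    by apply: Rintegral_ge0 => w _; rewrite -expr2 sqr_ge0.
  rewrite (_ : \int[P]_w _ = \int[P]_w (N w * N w - (2 * EN) * N w + EN ^+ 2)); last first.
    by apply: eq_Rintegral => w _; ring.
  have bc := bounded_rv_cst path (EN ^+ 2).
  have b1 := bounded_rvM bN bN; have b2 := bounded_rvZ (2 * EN) bN.
  rewrite (expectationD P (bounded_rvB b1 b2) bc) (expectationB P b1 b2).
  by rewrite expectationZ // -ENE expectation_cst; lra.
have second : \int[P]_w (N w * N w) <= 2 * G * EN.
  pose M w : R := \sum_(i < n) \sum_(k < n)
    delta l (walk i w) * delta 0 (walk k (shiftn i w)).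
  have bM : bounded_rv M.
    apply: bounded_rv_sum => i; apply: bounded_rv_sum => k; apply: bounded_rvM => //.
    apply: bounded_rv_lattice; first exact: delta_bounded.
    by apply: measurableT_comp; [exact: measurable_walk|exact: (measurable_shiftn hP)].
  apply: (@le_trans _ _ (\int[P]_w (2 * M w))).
    apply: le_expectation; [exact: bounded_rvM|exact: bounded_rvZ|move=> w].
    (* Being at [l] at times [i] and [i + k] means being at [l] at time [i] and returning to the
       starting point in the next [k] steps. *)
    have dd i k : delta l (walk i w) * delta l (walk (i + k) w) =
        delta l (walk i w) * delta 0 (walk k (shiftn i w)).
      rewrite /delta walkD; case: (walk i w =P l) => [->|]; last by rewrite !mul0r.
      by rewrite -subr_eq0 addrC addrA addNr add0r.
    rewrite /N mulr_suml; under eq_bigr => i _ do rewrite mulr_sumr.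
    rewrite (sum_square (fun i j => delta l (walk i w) * delta l (walk j w))).
    rewrite /M mulr_sumr; apply: ler_sum => i _.
    have ni : (0 < n)%N by case: n i {bN EN ENE EN0 jensen M bM N hG} => // -[].
    have d0 k : 0 <= delta l (walk i w) * delta 0 (walk k (shiftn i w)).
      by rewrite mulr_ge0 // ler0n.
    (* The diagonal term, present once, is counted twice in order to become the term [k = 0]. *)
    apply: (@le_trans _ _ (2 * \sum_(0 <= k < n - i)
        delta l (walk i w) * delta 0 (walk k (shiftn i w)))).
      rewrite [X in _ <= 2 * X]big_ltn ?subn_gt0 // mulrDr lerD //.
        have := dd i 0%N; rewrite addn0 => ->.
        by rewrite ler_peMl ?ler1n.
      rewrite mulr_sumr ler_sum // => k _.
      by rewrite [X in _ + X]mulrC dd; lra.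
    rewrite ler_pM2l // -[X in _ <= X](big_mkord xpredT (fun k =>
      delta l (walk i w) * delta 0 (walk k (shiftn i w)))).
    rewrite [X in _ <= X](@big_cat_nat _ _ _ (n - i)%N) ?leq_subr //= lerDl.
    by apply: sumr_ge0.
  rewrite expectationZ // -mulrA ler_pM2l // expectation_sum; last first.
    move=> i; apply: bounded_rv_sum => k; apply: bounded_rvM => //.
    apply: bounded_rv_lattice; first exact: delta_bounded.
    by apply: measurableT_comp; [exact: measurable_walk|exact: (measurable_shiftn hP)].
  rewrite /EN mulr_sumr; apply: ler_sum => i _.
  rewrite expectation_sum; last first.
    move=> k; apply: bounded_rvM => //.
    apply: bounded_rv_lattice; first exact: delta_bounded.
    by apply: measurableT_comp; [exact: measurable_walk|exact: (measurable_shiftn hP)].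
  have -> : \sum_(k < n) \int[P]_w (delta l (walk i w) * delta 0 (walk k (shiftn i w)))
      = (\sum_(k < n) ker P (delta 0) k 0) * ker P (delta l) i 0.
    rewrite mulr_suml; apply: eq_bigr => k _.
    rewrite (expectation_past_shift hP (bdelta i) (G := fun w => delta 0 (walk k w))).
    - rewrite mulrC; congr (_ * _); apply: eq_Rintegral => w _; by rewrite add0r.
    - by apply: bounded_rv_lattice; [exact: delta_bounded|exact: measurable_walk].
    - by move=> w w' h; rewrite (walk_past h).
    - by move=> w w' h; rewrite (walk_future k h).
  by rewrite ler_wpM2r ?ker_delta_ge0.
move: EN0; rewrite le_eqVlt => /orP[/eqP <-|EN0].
  by rewrite mulr_ge0 // ltW.
by rewrite -(ler_pM2r EN0) -expr2; exact: le_trans jensen second.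
Qed.

End transient.

End green.

(** * Asymptotic variance in mean *)

Lemma is_cvg_summable (R : realType) (e : nat -> R) (C : R) :
  (forall n, \sum_(k < n) `|e k| <= C) ->
  exists s : R, (fun n => \sum_(1 <= k < n) e k) @ \oo --> s.
Proof.
move=> hC; have cn : cvgn (series (fun k => `|e k|)).
  apply: nondecreasing_is_cvgn.
    by apply: nondecreasing_series => k _ _.
  by exists C => _ [n _ <-]; rewrite /series /= big_mkord.
have /cvg_ex[/= l cl] := normed_cvg cn.
(* The sums start at 1, hence the limit of the full series is corrected by its term of index 0. *)
exists (l - e 0%N); rewrite -(cvg_shiftS (fun n => \sum_(1 <= k < n) e k)) /=.
rewrite (_ : (fun n => _) = (fun n => series e n.+1 - e 0%N)).
  by apply: cvgB; [rewrite (cvg_shiftS (series e))|exact: cvg_cst].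
by apply/funext => n; rewrite /series /= [in RHS]big_ltn // addrC addKr.
Qed.

(** Read backwards, this is the Cesaro mean of [u 1, ..., u n]. *)
Lemma cvg_mean_rev (R : realType) (u : nat -> R) (s : R) : u @ \oo --> s ->
  (fun n => n%:R^-1 * \sum_(i < n) u (n - i)%N) @ \oo --> s.
Proof.
move=> us; rewrite -cvg_shiftS /=.
rewrite (_ : (fun n => _) = arithmetic_mean (fun n => u n.+1)).
  by apply: cesaro; rewrite (cvg_shiftS u).
apply/funext => n; rewrite /arithmetic_mean /= /series /= big_mkord.
rewrite (reindex_inj rev_ord_inj) /=; congr (_ * _); apply: eq_bigr => i _.
by rewrite subSS subSn ?leq_subr // subKn // -ltnS.
Qed.

Section summable.
Context (d : nat) (R : realType).
Context (nu : probability (lattice d) R) (P : probability (path_space d) R).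
Hypothesis hP : is_product_measure nu P.
Hypothesis htransient : transient P.
Variable phi : lattice d -> R.
Hypothesis hphi : (\esum_(l in [set: lattice d]) `|phi l|%:E < +oo)%E.

Local Notation path := (path_space d).

Lemma summable_bounded : bounded_on_lattice phi.
Proof.
have := hphi; set S := (\esum_(l in _) _)%E => hS.
have S0 : (0 <= S)%E by apply: esum_ge0 => l _; rewrite lee_fin.
exists (fine S) => l; rewrite -lee_fin fineK ?ge0_fin_numE //.
apply: esum_ge; exists [set l]; first by split.
by rewrite fsbig_set1.
Qed.

Lemma abs_bounded : bounded_on_lattice (fun l => `|phi l|).
Proof. by have [C hC] := summable_bounded; exists C => l; rewrite normr_id. Qed.

(** Exchanging the sums, each lattice point [l] contributes its weight times the expected number of
    visits to [l - x], which [green] bounds uniformly. *)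
Lemma ker_summable : exists2 C : R, 0 <= C & forall n x,
  \sum_(k < n) ker P (fun l => `|phi l|) k x <= C.
Proof.
have := hphi; set S := (\esum_(l in _) _)%E => hS.
have S0 : (0 <= S)%E by apply: esum_ge0 => l _; rewrite lee_fin.
have [G G0 hG] := green hP htransient.
(* An integer bound lets the product of [N] and the total mass be written as a sum of [N] copies, so
   that both sides are compared as sums over the lattice. *)
have [N GN] : exists N : nat, G <= N%:R.
  by exists (Num.bound G); apply/ltW; apply: archi_boundP; exact: ltW.
exists (\sum_(i < N) fine S); first by apply: sumr_ge0 => i _; exact: fine_ge0.
move=> n x; rewrite -lee_fin -!sumEFin.
pose p k l := P [set w : path | x + walk k w = l].
have mp k : measurable_fun [set: path] (fun w : path => x + walk k w).
  by apply: measurable_latticeD => //; exact: measurable_walk.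
have kE k : ((ker P (fun l => `|phi l|) k x)%:E =
    \esum_(l in [set: lattice d]) (`|phi l|%:E * p k l))%E.
  rewrite /ker /Rintegral fineK; last first.
    apply: (integrable_fin_num measurableT (bounded_rv_integrableP P _)).
    exact: bounded_rv_ker abs_bounded.
  exact: (integral_lattice P (g := fun l => `|phi l|%:E) (mp k)).
under eq_bigr => k _ do rewrite kE.
rewrite -esum_sum; last by move=> l k _ _; rewrite mule_ge0.
under [X in (_ <= X)%E]eq_bigr => k _ do rewrite fineK ?ge0_fin_numE //.
rewrite /S -[X in (_ <= X)%E]esum_sum; last by move=> l k _ _; rewrite lee_fin.
apply: le_esum => l _.
have pE k : p k l = (ker P (delta R (l - x)) k 0)%:E.
  rewrite ker_delta fineK ?fin_num_measure //.
    congr (P _); apply/seteqP; split => w /=; first by move=> <-; rewrite addrC addKr.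
    by move=> ->; rewrite addrC subrK.
  by apply: measurable_eq_lattice; exact: measurable_walk.
under eq_bigr => k _ do rewrite pE -EFinM.
rewrite !sumEFin lee_fin -mulr_sumr sumr_const card_ord -mulr_natr.
by rewrite ler_wpM2l //; exact: le_trans (hG n _) GN.
Qed.

(** Links the formula of the theorem with [ker]: positive and negative parts are each an expectation
    with respect to the law of [walk k]. *)
Lemma lattice_sum_ker k :
  lattice_sum (fun l => fine (P [set w | walk k w = l]) * phi l) =
  (ker P phi k 0)%:E.
Proof.
have bphi := bounded_rv_ker k 0 summable_bounded.
rewrite /ker /Rintegral fineK; last first.
  exact: (integrable_fin_num measurableT (bounded_rv_integrableP P bphi)).
under [RHS]eq_integral => w _ do rewrite add0r.
rewrite integralE /lattice_sum.
have mw := @measurable_walk d k.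
have fP l : P [set w | walk k w = l] \is a fin_num.
  by rewrite fin_num_measure //; exact: measurable_eq_lattice.
have iL (g : lattice d -> \bar R) : (forall l, 0 <= g l)%E ->
  (\int[P]_w g (walk k w) =
   \esum_(l in [set: lattice d]) (g l * (fine (P [set w | walk k w = l]))%:E))%E.
  move=> g0; rewrite (integral_lattice P mw g0); apply: eq_esum => l _.
  by congr (_ * _)%E; exact: (esym (fineK (fP l))).
apply: (f_equal2 (fun a b => a - b)%E).
- transitivity (\int[P]_w ((EFin \o phi)^\+ (walk k w)))%E.
    rewrite iL //; apply: eq_esum => l _.
    rewrite !funeposE /= -!EFin_max -!EFinM; congr EFin.
    by rewrite maxr_pMl ?fine_ge0 // mul0r mulrC.
  by apply: eq_integral => w _; rewrite !funeposE.
- transitivity (\int[P]_w ((EFin \o phi)^\- (walk k w)))%E.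
    rewrite iL //; apply: eq_esum => l _.
    rewrite !funenegE /= -!EFin_max -!EFinM; congr EFin.
    by rewrite maxr_pMl ?fine_ge0 // mul0r mulNr mulrC.
  by apply: eq_integral => w _; rewrite !funenegE.
Qed.

Lemma ker_le_abs k x : `|ker P phi k x| <= ker P (fun l => `|phi l|) k x.
Proof.
by apply: le_norm_expectation; apply: bounded_rv_ker; exact: summable_bounded.
Qed.

Lemma is_cvg_ker_sum x : exists s : R, (fun n => \sum_(1 <= k < n) ker P phi k x) @ \oo --> s.
Proof.
have [C _ hC] := ker_summable; apply: (is_cvg_summable (C := C)) => n.
by apply: le_trans (hC n x); apply: ler_sum => k _; exact: ker_le_abs.
Qed.

Section variance.
Hypothesis phiN : forall l, phi (- l) = phi l.

(** The displacement between times [i] and [i + k] is [walk k] of the shifted path; the two orders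
    of a pair give equal terms as [phi] is even. *)
Lemma variance_walk n (w : path) :
  \sum_(i < n) \sum_(j < n) phi (walk i w - walk j w) =
  \sum_(i < n) (phi 0 + 2 * \sum_(1 <= k < n - i) phi (walk k (shiftn i w))).
Proof.
rewrite (sum_square (fun i j => phi (walk i w - walk j w))).
apply: eq_bigr => i _; rewrite subrr; congr (_ + _).
rewrite mulr_sumr; apply: eq_bigr => k _.
rewrite -phiN opprB walkD addrAC subrr add0r.
by rewrite mulr_natl mulr2n.
Qed.

Lemma expectation_variance n :
  \int[P]_w (\sum_(i < n) \sum_(j < n) phi (walk i w - walk j w)) =
  \sum_(i < n) (phi 0 + 2 * \sum_(1 <= k < n - i) ker P phi k 0).
Proof.
under eq_Rintegral => w _ do rewrite variance_walk.
have b1 i k : bounded_rv (fun w : path => phi (walk k (shiftn i w))).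
  apply: bounded_rv_lattice; first exact: summable_bounded.
  by apply: measurableT_comp; [exact: measurable_walk|exact: (measurable_shiftn hP)].
have b2 i : bounded_rv (fun w : path => \sum_(1 <= k < n - i) phi (walk k (shiftn i w))).
  by apply: bounded_rv_sum.
have b0 := bounded_rv_cst path (phi 0).
rewrite expectation_sum => [|i]; last exact: bounded_rvD (bounded_rvZ 2 (b2 i)).
apply: eq_bigr => i _; rewrite (expectationD P b0 (bounded_rvZ 2 (b2 i))).
rewrite expectation_cst expectationZ // expectation_sum //; congr (_ + 2 * _).
apply: eq_bigr => k _; rewrite -(expectation_walk_shift hP k 0 i summable_bounded).
by apply: eq_Rintegral => w _; rewrite add0r.
Qed.

Lemma cvg_expectation_variance (s : R) :
  (fun n => \sum_(1 <= k < n) ker P phi k 0) @ \oo --> s ->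
  (fun n => n%:R^-1 *
     \int[P]_w (\sum_(i < n) \sum_(j < n) phi (walk i w - walk j w))) @ \oo
    --> phi 0 + 2 * s.
Proof.
move=> cs; under eq_fun do rewrite expectation_variance.
apply: (cvg_mean_rev (u := fun n => phi 0 + 2 * \sum_(1 <= k < n) ker P phi k 0)).
by apply: cvgD; [exact: cvg_cst|apply: cvgMr].
Qed.

End variance.

End summable.

(** * Asymptotic variance along almost every path *)

Section quenched.
Context (d : nat) (R : realType).
Context (nu : probability (lattice d) R) (P : probability (path_space d) R).
Hypothesis hP : is_product_measure nu P.
Hypothesis htransient : transient P.

Local Notation path := (path_space d).

Section upper.
Variable phi : lattice d -> R.
Hypothesis hphi : (\esum_(l in [set: lattice d]) `|phi l|%:E < +oo)%E.

Let bphi := summable_bounded hphi.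

(** The absolute tail [h_K]. It is kept in [\bar R] since its finiteness will hold only almost
    surely. *)
Let tail K (w : path) : \bar R :=
  (\sum_(0 <= j <oo) `|phi (walk (K + j) w)|%:E)%E.

Let measurable_term k :
  measurable_fun [set: path] (fun w : path => (`|phi (walk k w)|%:E)%E).
Proof.
apply/measurable_EFinP/measurableT_comp => //.
exact: (measurableT_comp (measurable_lattice_fun phi) (measurable_walk k)).
Qed.

Let measurable_tail K : measurable_fun [set: path] (tail K).
Proof. by apply: ge0_emeasurable_sum => // j w _ _; rewrite lee_fin. Qed.

Let tail_ge0 K w : (0 <= tail K w)%E.
Proof. by apply: nneseries_ge0 => j _ _; rewrite lee_fin. Qed.

Let integral_tail K :
  (\int[P]_w tail K w = \sum_(0 <= j <oo) (ker P (fun l => `|phi l|) (K + j) 0)%:E)%E.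
Proof.
rewrite integral_nneseries //.
apply: eq_eseriesr => j _; rewrite /ker /Rintegral fineK.
  by apply: eq_integral => w _; rewrite add0r.
apply: (integrable_fin_num measurableT (bounded_rv_integrableP P _)).
exact: bounded_rv_ker (abs_bounded hphi).
Qed.

Let tail_small (e : R) : 0 < e ->
  exists K0, forall K, (K0 <= K)%N -> (\int[P]_w tail K w <= e%:E)%E.
Proof.
move=> e0; have [C C0 hC] := ker_summable hP htransient hphi.
pose u k := ker P (fun l => `|phi l|) k 0.
have u0 k : 0 <= u k by apply: Rintegral_ge0.
have : cvgn (series u).
  apply: nondecreasing_is_cvgn; first by apply: nondecreasing_series => k _ _.
  by exists C => _ [n _ <-]; rewrite /series /= big_mkord; exact: hC.
move=> /cvg_ex[/= l cl].
have ul n : series u n <= l.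
  rewrite -(cvg_lim _ cl) //; apply: nondecreasing_cvgn_le.
    by apply: nondecreasing_series => k _ _.
  by apply/cvg_ex; exists l.
have /cvgrPdist_le/(_ _ e0)[K0 _ hK0] := cl.
exists K0 => K K0K; rewrite integral_tail.
apply: lime_le.
  by apply: is_cvg_nneseries => j _ _; rewrite lee_fin; exact: u0.
apply: nearW => n; rewrite sumEFin lee_fin.
have -> : \sum_(0 <= j < n) u (K + j)%N = series u (K + n)%N - series u K.
  rewrite /series /= [in RHS](@big_cat_nat _ _ _ K) ?leq_addr //= addrAC subrr add0r.
  by rewrite -[RHS]/(\sum_(0 + K <= j < K + n) u j) big_addn addKn; apply: eq_bigr => j _; rewrite addnC.
have := hK0 K K0K; rewrite /= ger0_norm ?subr_ge0 //; have := ul (K + n)%N; lra.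
Qed.

Let tail_fin K : (\int[P]_w tail K w < +oo)%E ->
  {ae P, forall w, forall i, tail K (shiftn i w) \is a fin_num}.
Proof.
move=> Ioo; apply: ae_foralln => i.
apply: (preserving_ae (Q := fun w => tail K w \is a fin_num) (shiftn_preserving hP i)).
have iT : P.-integrable [set: path] (tail K).
  apply/integrableP; split => //; under eq_integral => w _ do rewrite gee0_abs //.
  exact: Ioo.
have := integrable_ae measurableT iT.
by apply: filterS => w; apply.
Qed.

(** Correction for inner sums shorter than [K]: both such a sum and the one up to [K] are at most
    [K * A] in absolute value. It is eventually zero, so its mean over [i < n] vanishes in the
    limit. *)
Let r (K : nat) (A : R) (m : nat) : R := if (m < K)%N then 2 * (K%:R * A) else 0.

Let partial_le K A m w : (0 < K)%N -> (forall l, `|phi l| <= A) ->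
  tail K w \is a fin_num ->
  \sum_(1 <= k < m) phi (walk k w) <=
  (\sum_(1 <= k < K) phi (walk k w) + fine (tail K w)) + r K A m.
Proof.
move=> K0 hA ft; rewrite /r.
have A0 : 0 <= A by exact: le_trans (hA 0).
have t0 : 0 <= fine (tail K w) by exact: fine_ge0.
have bd n : (n <= K)%N -> `|\sum_(1 <= k < n) phi (walk k w)| <= K%:R * A.
  move=> nK; apply: le_trans (ler_norm_sum _ _ _) _.
  apply: (@le_trans _ _ (\sum_(1 <= k < n) A)); first exact: ler_sum.
  rewrite sumr_const_nat -[A *+ _]mulr_natl ler_wpM2r // ler_nat.
  by apply: leq_trans nK; exact: leq_subr.
case: (ltnP m K) => mK.
  have := bd m (ltnW mK); have := bd K (leqnn K).
  rewrite !ler_norml => /andP[h1 _] /andP[_ h2]; lra.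
rewrite addr0 (@big_cat_nat _ _ _ K) //= lerD2l.
apply: (@le_trans _ _ (\sum_(K <= k < m) `|phi (walk k w)|)).
  by apply: ler_sum => k _; exact: ler_norm.
rewrite -lee_fin fineK // -sumEFin.
rewrite -[X in (X <= _)%E]/(\sum_(0 + K <= k < m) `|phi (walk k w)|%:E)%E big_addn.
rewrite /tail; under eq_bigr => j _ do rewrite addnC.
by apply: nneseries_lim_ge => j _ _; rewrite lee_fin.
Qed.

Lemma quenched_upper (s e : R) : 0 < e ->
  (fun n => \sum_(1 <= k < n) ker P phi k 0) @ \oo --> s ->
  {ae P, forall w, \forall n \near \oo,
    n%:R^-1 * \sum_(i < n) \sum_(1 <= k < n - i) phi (walk k (shiftn i w)) <= s + e}.
Proof.
move=> e0 cs; have [A hA] := bphi.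
(* Budget: [e / 4] for the truncation, [e / 4] for the mean tail, [e / 4] for the strict inequality
   required by [birkhoff_upper], and [e / 8] each for its constant and for the correction [r]. *)
have e4 : 0 < e / 4 by rewrite divr_gt0.
have [K0 hK0] := tail_small e4.
have /cvgrPdist_le/(_ _ e4)[K1 _ hK1] := cs.
(* The successor ensures [0 < K], so that a sum from 1 can be split at [K]. *)
pose K := (maxn K0 K1).+1.
have hT : (\int[P]_w tail K w <= (e / 4)%:E)%E.
  by apply: hK0; rewrite (leq_trans (leq_maxl K0 K1)).
have hS : \sum_(1 <= k < K) ker P phi k 0 <= s + e / 4.
  have := hK1 K (leq_trans (leq_maxr K0 K1) (leqnSn _)).
  by rewrite /= ler_norml => /andP[h1 h2]; lra.
pose G (w : path) : R := \sum_(1 <= k < K) phi (walk k w).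
have bG : bounded_rv G.
  apply: bounded_rv_sum => k; apply: bounded_rv_lattice; first by exists A.
  exact: measurable_walk.
pose H (w : path) : R := fine (tail K w).
have H0 w : 0 <= H w by exact: fine_ge0.
have HT w : (`|(H w)%:E| <= `|tail K w|)%E.
  rewrite (gee0_abs (tail_ge0 K w)) gee0_abs ?lee_fin // /H.
  by case: (tail K w) (tail_ge0 K w) => [x||] //= _; rewrite leey.
have mH : measurable_fun [set: path] (EFin \o H).
  by apply/measurable_EFinP; exact: (measurableT_comp (fine_measurable measurableT)).
have iT : P.-integrable [set: path] (tail K).
  apply/integrableP; split => //; under eq_integral => w _ do rewrite gee0_abs //.
  exact: le_lt_trans hT (ltry _).
have iH : P.-integrable [set: path] (EFin \o H).
  by apply: le_integrable iT => // w _; exact: HT.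
have EH : \int[P]_w H w <= e / 4.
  rewrite -lee_fin /Rintegral fineK ?(integrable_fin_num measurableT iH) //.
  apply: le_trans hT; apply: ge0_le_integral => //; first by move=> w _; rewrite lee_fin.
  by move=> w _; have := HT w; rewrite (gee0_abs (tail_ge0 K w)) gee0_abs ?lee_fin.
have iG := bounded_rv_integrableP P bG.
have EG : \int[P]_w G w = \sum_(1 <= k < K) ker P phi k 0.
  rewrite expectation_sum.
    by apply: eq_bigr => k _; apply: eq_Rintegral => w _; rewrite add0r.
  move=> k; apply: bounded_rv_lattice; first by exists A.
  exact: measurable_walk.
have iGH : P.-integrable [set: path] (EFin \o fun w => G w + H w).
  exact: (integrableD measurableT iG iH).
have EGH : \int[P]_w (G w + H w) < s + 3 / 4 * e by rewrite RintegralD // EG; lra.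
have fGH : future_of (fun w => G w + H w).
  move=> w w' ww'; congr (_ + _).
    by apply: eq_bigr => k _; rewrite (walk_future k ww').
  rewrite /H; congr fine; apply: eq_eseriesr => j _.
  by rewrite (walk_future (K + j) ww').
have ae1 := birkhoff_upper hP iGH fGH EGH.
have ae2 := tail_fin (le_lt_trans hT (ltry _)).
apply: filterS2 ae1 ae2 => w [C hC] ft.
have cr : (fun n => n%:R^-1 * \sum_(i < n) r K A (n - i)) @ \oo --> (0 : R).
  apply: cvg_mean_rev; apply: cvg_near_cst; exists K => // m /= Km.
  by rewrite /r ltnNge Km.
have e8 : 0 < e / 8 by rewrite divr_gt0.
have /cvgrPdist_le/(_ _ e8) near1 := cr.
have cC : (fun n : nat => n%:R^-1 * C) @ \oo --> (0 : R).
  rewrite -(mul0r C) -cvg_shiftS /=; apply: cvgMl; exact: cvg_harmonic.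
have /cvgrPdist_le/(_ _ e8) near2 := cC.
near=> n.
have n0 : 0 < n%:R :> R by rewrite ltr0n; near: n; exact: nbhs_infty_gt.
have h1 : n%:R^-1 * \sum_(i < n) r K A (n - i) <= e / 8.
  have : `|0 - n%:R^-1 * \sum_(i < n) r K A (n - i)| <= e / 8 by near: n.
  by rewrite sub0r normrN; apply: le_trans; exact: ler_norm.
have h2 : n%:R^-1 * C <= e / 8.
  have : `|0 - n%:R^-1 * C| <= e / 8 by near: n.
  by rewrite sub0r normrN; apply: le_trans; exact: ler_norm.
apply: (@le_trans _ _ (n%:R^-1 * (birkhoff (fun w => G w + H w) n w +
    \sum_(i < n) r K A (n - i)))).
  rewrite ler_wpM2l ?invr_ge0 ?(ltW n0) // /birkhoff -big_split /=.
  by apply: ler_sum => i _; exact: partial_le.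
have h3 : n%:R^-1 * birkhoff (fun w => G w + H w) n w <= s + 3 / 4 * e + n%:R^-1 * C.
  rewrite -(ler_pM2l n0) mulVKf ?gt_eqF // mulrDr mulVKf ?gt_eqF ?hC //.
rewrite mulrDr; lra.
Unshelve. all: by end_near.
Qed.

End upper.

Section cvg.
Variable phi : lattice d -> R.
Hypothesis hphi : (\esum_(l in [set: lattice d]) `|phi l|%:E < +oo)%E.
Hypothesis phiN : forall l, phi (- l) = phi l.

Lemma quenched_cvg (s : R) :
  (fun n => \sum_(1 <= k < n) ker P phi k 0) @ \oo --> s ->
  {ae P, forall w, (fun n => n%:R^-1 *
     \sum_(i < n) \sum_(j < n) phi (walk i w - walk j w)) @ \oo --> phi 0 + 2 * s}.
Proof.
move=> cs.
pose Y n w := n%:R^-1 * \sum_(i < n) \sum_(1 <= k < n - i) phi (walk k (shiftn i w)).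
(* The one-sided bound is used for [phi] and for [- phi], with errors taken in a countable family so
   that a single null set is discarded. *)
have aeY : {ae P, forall w, forall m : nat, \forall n \near \oo, `|s - Y n w| <= m.+1%:R^-1}.
  apply: ae_foralln => m.
  have m0 : 0 < m.+1%:R^-1 :> R by rewrite invr_gt0 ltr0n.
  have hN : (\esum_(l in [set: lattice d]) `|- phi l|%:E < +oo)%E.
    by under eq_esum => l _ do rewrite normrN.
  have csN : (fun n => \sum_(1 <= k < n) ker P (fun l => - phi l) k 0) @ \oo --> - s.
    rewrite (_ : (fun n => _) = (fun n => - \sum_(1 <= k < n) ker P phi k 0)).
      exact: cvgN.
    apply/funext => n; rewrite -sumrN; apply: eq_bigr => k _; rewrite /ker.
    under eq_Rintegral => w _ do rewrite -mulN1r.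
    by rewrite expectationZ ?mulN1r //; apply: bounded_rv_ker; exact: summable_bounded.
  have := quenched_upper hN m0 csN.
  apply: filterS2 (quenched_upper hphi m0 cs) => w h1 h2.
  near=> n.
  have h3 : Y n w <= s + m.+1%:R^-1 by near: n.
  have h4 : - Y n w <= - s + m.+1%:R^-1.
    rewrite /Y -mulrN -sumrN; under eq_bigr => i _ do rewrite -sumrN.
    by near: n.
  move: h3 h4; move: (Y n w) (m.+1%:R^-1) => y e h3 h4.
  by rewrite ler_norml; apply/andP; split; lra.
apply: filterS aeY => w hY.
have cY : Y ^~ w @ \oo --> s.
  apply/cvgrPdist_le => e e0.
  have [m hm] : exists m : nat, m.+1%:R^-1 <= e.
    exists (Num.bound e^-1); rewrite invf_ple ?posrE ?ltr0n //.
    apply: ltW; apply: (@lt_trans _ _ (Num.bound e^-1)%:R).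
      by apply: archi_boundP; rewrite invr_ge0 ltW.
    by rewrite ltr_nat.
  by apply: filterS (hY m) => n h; exact: le_trans h hm.
(* At [n = 0] the factor [n%:R^-1] is 0 and the constant [phi 0] would be lost. *)
rewrite -cvg_shiftS /=.
rewrite (_ : (fun n => _) = (fun n => phi 0 + 2 * Y n.+1 w)); last first.
  apply/funext => n; rewrite variance_walk // big_split /= sumr_const card_ord.
  rewrite -mulr_sumr mulrDr -[phi 0 *+ _]mulr_natl mulKf ?pnatr_eq0 //.
  by rewrite mulrCA.
apply: cvgD; first exact: cvg_cst.
by apply: cvgMr; rewrite (cvg_shiftS (Y ^~ w)).
Unshelve. all: by end_near.
Qed.

End cvg.

End quenched.

(** * Positivity of the asymptotic variance *)

Section positivity.
Context (d : nat) (R : realType).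
Context (nu : probability (lattice d) R) (P : probability (path_space d) R).
Hypothesis hP : is_product_measure nu P.

Local Notation path := (path_space d).

(** Otherwise summing the law of the first step over the lattice would leave the whole mass 1 at
    [l]. *)
Lemma second_point : ~ deterministic P -> forall l : lattice d,
  exists2 l', l' != l & 0 < fine (P [set w : path | w 0 = l']).
Proof.
move=> ndet l; apply: contrapT => h; apply: ndet; exists l.
have m0 := @measurable_coord d 0.
have P0 l' : l' != l -> P [set w : path | w 0 = l'] = 0%E.
  move=> l'l; have fP : P [set w : path | w 0 = l'] \is a fin_num.
    by rewrite fin_num_measure //; exact: measurable_eq_lattice.
  rewrite -(fineK fP); congr EFin; apply/eqP; rewrite eq_le fine_ge0 // andbT.
  by rewrite leNgt; apply/negP => lt0; apply: h; exists l'.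
have /esym := integral_lattice P (g := fun=> 1%E) m0 (fun=> lee01).
rewrite integral_cst // mul1e => e1.
transitivity (P [set: path]); last exact: probability_setT.
rewrite -[RHS]e1 -(esum_set1 (a := fun l => P [set w : path | w 0 = l])) //.
rewrite esum_mkcond; apply: eq_esum => l' _; rewrite mul1e.
case: ifPn => //; rewrite notin_setE /= => /eqP l'l.
by apply/esym; exact: P0.
Qed.

Variable phi : lattice d -> R.
Hypothesis phiN : forall l, phi (- l) = phi l.
Hypothesis phi_pos : forall n (c : nat -> R) (z : nat -> lattice d),
  0 <= \sum_(i < n) \sum_(j < n) c i * c j * phi (z i - z j).

Section perturbation.
Variables (psi : lattice d -> R) (t : R) (q : lattice d).

(* Squared norm of [\sum_i (T^(Z_i) f + t psi(zeta_i) T^(Z_i + q) f)]. *)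
Let B (w : path) (i j : nat) : R :=
  phi (walk i w - walk j w)
  + 2 * t * psi (w j) * phi (walk i w - walk j w - q)
  + t ^+ 2 * psi (w i) * psi (w j) * phi (walk i w - walk j w).

Lemma perturbed_ge0 n w : 0 <= \sum_(i < n) \sum_(j < n) B w i j.
Proof.
(* Positive definiteness is applied to [2n] points: the walk itself with weights 1, then its
   translates by [q] with the perturbing weights. *)
pose c i : R := if (i < n)%N then 1 else t * psi (w (i - n)%N%:Z).
pose z i : lattice d := if (i < n)%N then walk i w else walk (i - n) w + q.
have := phi_pos (n + n) c z; congr (_ <= _).
pose b3 i j := t * psi (w i%:Z) * phi (walk i w + q - walk j w).
transitivity (\sum_(i < n) \sum_(j < n) (phi (walk i w - walk j w)
   + t * psi (w j) * phi (walk i w - walk j w - q) + b3 i j +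
   t ^+ 2 * psi (w i) * psi (w j) * phi (walk i w - walk j w))).
  rewrite big_split_ord /= -big_split; apply: eq_bigr => i _ /=.
  rewrite !big_split_ord /= -!big_split; apply: eq_bigr => j _ /=.
  rewrite /c /z !ltn_ord !ltnNge !leq_addr /= !addKn /b3 opprD !addrA.
  rewrite (addrAC (walk i w)) (addrAC (walk i w) q) addrK.
  by ring.
(* The two mixed blocks agree by evenness of [phi], whence the factor 2 in [B]. *)
have e3 : \sum_(i < n) \sum_(j < n) b3 i j =
    \sum_(i < n) \sum_(j < n) t * psi (w j) * phi (walk i w - walk j w - q).
  rewrite exchange_big; apply: eq_bigr => j _; apply: eq_bigr => i _.
  by rewrite /b3 -[in LHS]phiN opprB opprD addrA.
transitivity (\sum_(i < n) \sum_(j < n) (phi (walk i w - walk j w)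
   + t * psi (w j) * phi (walk i w - walk j w - q) +
   t ^+ 2 * psi (w i) * psi (w j) * phi (walk i w - walk j w))
   + \sum_(i < n) \sum_(j < n) b3 i j).
  rewrite -big_split; apply: eq_bigr => i _; rewrite -big_split.
  by apply: eq_bigr => j _ /=; ring.
rewrite e3 -big_split; apply: eq_bigr => i _; rewrite -big_split.
by apply: eq_bigr => j _ /=; rewrite /B; ring.
Qed.

Let D0 (w : path) : R :=
  phi 0 + 2 * t * phi (- q) * psi (w 0) + t ^+ 2 * phi 0 * (psi (w 0) * psi (w 0)).

Let D k (w : path) : R :=
  2 * phi (walk k w) + 2 * t * (phi (walk k w + q) * psi (w k%:Z))
  + 2 * t * (psi (w 0) * phi (walk k w - q))
  + 2 * t ^+ 2 * (psi (w 0) * phi (walk k w) * psi (w k%:Z)).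

Lemma perturbed_sum n w : \sum_(i < n) \sum_(j < n) B w i j =
  \sum_(i < n) (D0 (shiftn i w) + \sum_(1 <= k < n - i) D k (shiftn i w)).
Proof.
rewrite (sum_square (B w)); apply: eq_bigr => i _.
have s0 : shiftn i w 0 = w i by rewrite /shiftn add0r.
congr (_ + _); first by rewrite /B /D0 s0 subrr sub0r; ring.
apply: eq_bigr => k _.
have sk : shiftn i w k%:Z = w (i + k)%N by rewrite /shiftn PoszD addrC.
rewrite /B /D s0 sk walkD.
rewrite (_ : walk i w - (walk i w + walk k (shiftn i w)) = - walk k (shiftn i w)).
  rewrite (_ : walk i w + walk k (shiftn i w) - walk i w = walk k (shiftn i w)).
    by rewrite -opprD !phiN; ring.
  by rewrite addrC addKr.
by rewrite opprD addrA subrr sub0r.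
Qed.

Hypothesis bphi : bounded_on_lattice phi.
Hypothesis bpsi : bounded_on_lattice psi.

Let bw (g : lattice d -> R) (i : int) : bounded_on_lattice g ->
  bounded_rv (fun w : path => g (w i)).
Proof. by move=> bg; apply: bounded_rv_lattice => //; exact: measurable_coord. Qed.

Let bz k (l : lattice d) : bounded_rv (fun w : path => phi (walk k w + l)).
Proof.
apply: bounded_rv_lattice => //; apply: measurable_latticeD => //.
exact: measurable_walk.
Qed.

Let bz0 k : bounded_rv (fun w : path => phi (walk k w)).
Proof. by apply: bounded_rv_lattice => //; exact: measurable_walk. Qed.

(** The contribution of a gap [k] to first order in [t]: the other terms with [psi] in [D k] carry
    the factor [psi (w k)], centered and independent of what precedes. *)
Definition drift k : R := \int[P]_w (psi (w 0) * phi (walk k w - q)).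

Hypothesis psi0 : \int[P]_w psi (w 0) = 0.

Let gam : R := phi 0 * \int[P]_w (psi (w 0) * psi (w 0)).

Let b3 k : bounded_rv (fun w : path => psi (w 0) * phi (walk k w - q)).
Proof. exact: (bounded_rvM (bw 0 bpsi) (bz k (- q))). Qed.
Let b2 k : bounded_rv (fun w : path => phi (walk k w + q) * psi (w k%:Z)).
Proof. exact: (bounded_rvM (bz k q) (bw k%:Z bpsi)). Qed.
Let b5 k : bounded_rv (fun w : path => psi (w 0) * phi (walk k w)).
Proof. exact: (bounded_rvM (bw 0 bpsi) (bz0 k)). Qed.
Let b4 k : bounded_rv (fun w : path => psi (w 0) * phi (walk k w) * psi (w k%:Z)).
Proof. exact: (bounded_rvM (b5 k) (bw k%:Z bpsi)). Qed.
Let b6 : bounded_rv (fun w : path => psi (w 0) * psi (w 0)).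
Proof. exact: (bounded_rvM (bw 0 bpsi) (bw 0 bpsi)). Qed.

Let bD0 : bounded_rv D0.
Proof.
exact: (bounded_rvD (bounded_rvD (bounded_rv_cst _ (phi 0))
  (bounded_rvZ (2 * t * phi (- q)) (bw 0 bpsi))) (bounded_rvZ (t ^+ 2 * phi 0) b6)).
Qed.

Let bD k : bounded_rv (D k).
Proof.
exact: (bounded_rvD (bounded_rvD (bounded_rvD (bounded_rvZ 2 (bz0 k))
  (bounded_rvZ (2 * t) (b2 k))) (bounded_rvZ (2 * t) (b3 k)))
  (bounded_rvZ (2 * t ^+ 2) (b4 k))).
Qed.

Let ED0 : \int[P]_w D0 w = phi 0 + t ^+ 2 * gam.
Proof.
have bc := bounded_rv_cst path (phi 0).
have b1 := bounded_rvZ (2 * t * phi (- q)) (bw 0 bpsi).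
rewrite /D0 (expectationD P (bounded_rvD bc b1) (bounded_rvZ (t ^+ 2 * phi 0) b6)).
rewrite (expectationD P bc b1) expectation_cst !expectationZ //; last exact: bw.
by rewrite psi0 mulr0 addr0 /gam mulrA.
Qed.

Let centered (F : path -> R) k : bounded_rv F -> past_of k F ->
  \int[P]_w (F w * psi (w k%:Z)) = 0.
Proof.
move=> bF pF.
have e : \int[P]_w (F w * psi (w k%:Z)) = \int[P]_w (F w * psi (shiftn k w 0)).
  by apply: eq_Rintegral => w _; rewrite /shiftn add0r.
rewrite e (expectation_past_shift hP bF (bw 0 bpsi) pF) ?psi0 ?mulr0 //.
by move=> w w' ww'; rewrite ww'.
Qed.

Let ED k : (0 < k)%N -> \int[P]_w D k w = 2 * ker P phi k 0 + 2 * t * drift k.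
Proof.
move=> k0; rewrite /D.
rewrite (expectationD P (bounded_rvD (bounded_rvD (bounded_rvZ 2 (bz0 k))
  (bounded_rvZ (2 * t) (b2 k))) (bounded_rvZ (2 * t) (b3 k)))
  (bounded_rvZ (2 * t ^+ 2) (b4 k))).
rewrite (expectationD P (bounded_rvD (bounded_rvZ 2 (bz0 k))
  (bounded_rvZ (2 * t) (b2 k))) (bounded_rvZ (2 * t) (b3 k))).
rewrite (expectationD P (bounded_rvZ 2 (bz0 k)) (bounded_rvZ (2 * t) (b2 k))).
rewrite !expectationZ // !centered //; first last.
- by move=> w w' ww'; rewrite (walk_past ww').
- by move=> w w' ww'; rewrite (walk_past ww') ww' // ltz_nat.
rewrite !mulr0 !addr0; congr (2 * _ + _).
by apply: eq_Rintegral => w _; rewrite add0r.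
Qed.

Let Eshift (F : path -> R) i : bounded_rv F ->
  \int[P]_w F (shiftn i w) = \int[P]_w F w.
Proof. by move=> bF; exact: (preserving_Rintegral (shiftn_preserving hP i) bF.1). Qed.

Let bshift (F : path -> R) i : bounded_rv F -> bounded_rv (fun w => F (shiftn i w)).
Proof.
move=> bF; apply: bounded_rv_comp; [exact: bF.1|exact: bF.2|].
exact: (measurable_shiftn hP).
Qed.

Lemma perturbed_expectation_ge0 n :
  0 <= \sum_(i < n) (phi 0 + t ^+ 2 * gam +
         \sum_(1 <= k < n - i) (2 * ker P phi k 0 + 2 * t * drift k)).
Proof.
have : 0 <= \int[P]_w (\sum_(i < n) \sum_(j < n) B w i j).
  by apply: Rintegral_ge0 => w _; exact: perturbed_ge0.
under eq_Rintegral => w _ do rewrite perturbed_sum.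
have bS i : bounded_rv (fun w => \sum_(1 <= k < n - i) D k (shiftn i w)).
  by apply: bounded_rv_sum => k; exact: bshift.
rewrite expectation_sum => [|i]; last exact: bounded_rvD (bshift i bD0) (bS i).
congr (_ <= _); apply: eq_bigr => i _.
rewrite (expectationD P (bshift i bD0) (bS i)) Eshift // ED0; congr (_ + _).
rewrite expectation_sum => [|k]; last exact: bshift.
rewrite big_nat_cond [RHS]big_nat_cond; apply: eq_bigr => k /andP[/andP[k0 _] _].
by rewrite Eshift // ED.
Qed.

(** Divided by [n], the nonnegative expectation is a reversed Cesaro mean of a convergent
    sequence. *)
Lemma perturbed_limit (s b : R) :
  (fun n => \sum_(1 <= k < n) ker P phi k 0) @ \oo --> s ->
  (fun n => \sum_(1 <= k < n) drift k) @ \oo --> b ->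
  0 <= phi 0 + t ^+ 2 * gam + (2 * s + 2 * t * b).
Proof.
move=> cs cb.
have cu : (fun n => phi 0 + t ^+ 2 * gam +
    \sum_(1 <= k < n) (2 * ker P phi k 0 + 2 * t * drift k)) @ \oo -->
    phi 0 + t ^+ 2 * gam + (2 * s + 2 * t * b).
  apply: cvgD; first exact: cvg_cst.
  under eq_fun do rewrite big_split /= -!mulr_sumr.
  by apply: cvgD; apply: cvgMr.
have := cvg_mean_rev cu; set v := _ + _; move=> cv.
rewrite -(cvg_lim _ cv) //; apply: limr_ge; first exact: cvgP cv.
by apply: nearW => n; rewrite mulr_ge0 ?invr_ge0 // perturbed_expectation_ge0.
Qed.

End perturbation.

End positivity.

(** * Periodicity of the Green sums and non-degeneracy *)

Section nondegenerate.
Context (d : nat) (R : realType).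
Context (nu : probability (lattice d) R) (P : probability (path_space d) R).
Hypothesis hP : is_product_measure nu P.
Hypothesis htransient : transient P.
Hypothesis hnondet : ~ deterministic P.

Local Notation path := (path_space d).

Variable phi : lattice d -> R.
Hypothesis hphi : (\esum_(l in [set: lattice d]) `|phi l|%:E < +oo)%E.
Hypothesis phiN : forall l, phi (- l) = phi l.
Hypothesis phi_pos : forall n (c : nat -> R) (z : nat -> lattice d),
  0 <= \sum_(i < n) \sum_(j < n) c i * c j * phi (z i - z j).
Hypothesis phi0 : 0 < phi 0.

Let bphi := summable_bounded hphi.

Let K n x := \sum_(k < n) ker P phi k x.

Lemma is_cvg_green_sum x : exists k : R, K ^~ x @ \oo --> k.
Proof.
have [s cs] := is_cvg_ker_sum hP htransient hphi x.
exists (ker P phi 0 x + s); rewrite -cvg_shiftS /=.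
rewrite (_ : (fun n => _) =
  fun n => ker P phi 0 x + \sum_(1 <= k < n.+1) ker P phi k x); last first.
  by apply/funext => n; rewrite /K -(big_mkord xpredT (fun k => ker P phi k x)) big_ltn.
apply: cvgD; first exact: cvg_cst.
by rewrite (cvg_shiftS (fun n => \sum_(1 <= k < n) ker P phi k x)).
Qed.

Let Kb : exists C, forall n x, `|K n x| <= C.
Proof.
have [C _ hC] := ker_summable hP htransient hphi.
exists C => n x; apply: le_trans (hC n x).
apply: le_trans (ler_norm_sum _ _ _) _; apply: ler_sum => k _.
exact: ker_le_abs.
Qed.

Section two_points.
Variables (l l' : lattice d).

Let mass x : R := fine (P [set w : path | w 0 = x]).

(** The crossed masses make [psi (w 0)] centered; paired with a function [g] it yields a multiple of
    [g l - g l']. *)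
Let psi (y : lattice d) : R := mass l' * delta R l y - mass l * delta R l' y.

Let bpsi : bounded_on_lattice psi.
Proof.
exists (`|mass l'| + `|mass l|) => y; apply: le_trans (ler_normB _ _) _.
by apply: lerD; rewrite normrM ler_piMr // /delta; case: eqP => _;
  rewrite ?normr1 ?normr0.
Qed.

Let bdelta x : bounded_rv (fun w : path => delta R x (w 0)).
Proof.
by apply: bounded_rv_lattice; [exact: delta_bounded|exact: measurable_coord].
Qed.

Let Edelta x : \int[P]_w delta R x (w 0) = mass x.
Proof. by apply: expectation_delta; exact: measurable_coord. Qed.

Let Epsi (g : lattice d -> R) :
  \int[P]_w (psi (w 0) * g (w 0)) = mass l * mass l' * (g l - g l').
Proof.
have dg x y : delta R x y * g y = g x * delta R x y.
  by rewrite /delta; case: eqP => [->|]; rewrite ?mul1r ?mulr1 ?mul0r ?mulr0.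
transitivity (\int[P]_w (mass l' * g l * delta R l (w 0) -
    mass l * g l' * delta R l' (w 0))).
  apply: eq_Rintegral => w _.
  by rewrite /psi mulrBl -!mulrA !dg.
rewrite (expectationB P (bounded_rvZ _ (bdelta l)) (bounded_rvZ _ (bdelta l'))).
by rewrite !expectationZ // !Edelta; ring.
Qed.

Let psi0 : \int[P]_w psi (w 0) = 0.
Proof.
have := Epsi (fun=> 1); rewrite subrr mulr0 => <-.
by apply: eq_Rintegral => w _; rewrite mulr1.
Qed.

(** The Markov property at time 1: after the first step, [k] steps remain, starting from
    [w 0 - q]. *)
Let driftE q k : drift P phi psi q k.+1 =
  mass l * mass l' * (ker P phi k (l - q) - ker P phi k (l' - q)).
Proof.
rewrite -(Epsi (fun y => ker P phi k (y - q))).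
have bw : bounded_rv (fun w : path => psi (w 0)).
  by apply: bounded_rv_lattice => //; exact: measurable_coord.
rewrite -(@expectation_walk _ _ _ _ hP phi k 1 (fun w => psi (w 0)) (fun w => w 0 - q)) //.
- apply: eq_Rintegral => w _; congr (_ * phi _).
  by rewrite -addn1 addnC walkD {1}/walk big_ord1 addrAC.
- by apply: measurable_latticeD => //; exact: measurable_coord.
- by move=> w w' ww'; rewrite ww'.
- by move=> w w' ww'; rewrite ww'.
Qed.

(* The variance of the perturbed sums is [2 t b + t^2 c] up to the factor [1/n];
   it would be negative for small [t] of the right sign if [b] were nonzero. *)
Lemma green_sum_periodic (s : R) :
  0 < mass l -> 0 < mass l' ->
  (fun n => \sum_(1 <= k < n) ker P phi k 0) @ \oo --> s -> phi 0 + 2 * s = 0 ->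
  forall x, limn (K ^~ (x + (l - l'))) = limn (K ^~ x).
Proof.
(* With this [q], the points [l - q] and [l' - q] are [x + (l - l')] and [x]. *)
move=> m0 m0' cs v0 x; pose q := l' - x.
have lq : l - q = x + (l - l') by rewrite /q opprB addrCA addrA addrC.
have lq' : l' - q = x by rewrite /q opprB addrCA subrr addr0.
have [k1 ck1] := is_cvg_green_sum (x + (l - l')).
have [k2 ck2] := is_cvg_green_sum x.
rewrite (cvg_lim _ ck1) // (cvg_lim _ ck2) //.
pose b := mass l * mass l' * (k1 - k2).
have cb : (fun n => \sum_(1 <= k < n) drift P phi psi q k) @ \oo --> b.
  rewrite -cvg_shiftS /=.
  rewrite (_ : (fun n => _) =
    (fun n => mass l * mass l' * (K n (x + (l - l')) - K n x))); last first.
    apply/funext => n; rewrite big_add1 /= big_mkord /K -sumrB mulr_sumr.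
    by apply: eq_bigr => k _; rewrite driftE lq lq'.
  by apply: cvgMr; exact: cvgB.
pose c := phi 0 * \int[P]_w (psi (w 0) * psi (w 0)).
have c0 : 0 <= c.
  by rewrite mulr_ge0 ?(ltW phi0) //; apply: Rintegral_ge0 => w _; rewrite -expr2 sqr_ge0.
have ineq t : 0 <= t ^+ 2 * c + 2 * t * b.
  have := perturbed_limit hP phiN phi_pos t bphi bpsi psi0 cs cb.
  rewrite -/c; move: v0; move: (t ^+ 2 * c) (2 * t * b) => u v; lra.
have b0 : b = 0.
  apply/eqP/negPn/negP => b0.
  (* The minimiser would be [- b / c]; the denominator [c + 1] also covers [c = 0] and still gives a
     negative value. *)
  have := ineq (- b / (c + 1)).
  have c1 : c + 1 != 0 by rewrite gt_eqF // ltr_wpDl.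
  rewrite (_ : _ + _ = - (b ^+ 2 * (c + 2) / (c + 1) ^+ 2)); last by field.
  rewrite oppr_ge0 leNgt divr_gt0 ?exprn_even_gt0 //= mulr_gt0 //.
    by rewrite exprn_even_gt0.
  by rewrite ltr_wpDl.
apply/eqP; rewrite -subr_eq0; apply/eqP.
by apply: (@mulfI _ (mass l * mass l')); rewrite ?mulr0 // gt_eqF // mulr_gt0.
Qed.

End two_points.

Let KS n x : K n.+1 x = phi x + \int[P]_w K n (x + w 0).
Proof.
rewrite /K big_ord_recl ker0; congr (_ + _).
rewrite expectation_sum; first by apply: eq_bigr => k _; exact: (kerS hP).
have [C hC] := bphi => k; apply: (bounded_rv_lattice (phi := ker P phi k)).
  by exists C => l; exact: ker_bounded.
by apply: measurable_latticeD => //; exact: measurable_coord.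
Qed.

Let cK x : K ^~ x @ \oo --> limn (K ^~ x).
Proof. by have [k ck] := is_cvg_green_sum x; rewrite (cvg_lim _ ck). Qed.

(** Conditioning on the first step gives the identity for truncated sums; their uniform bound
    permits the passage to the limit by dominated convergence. *)
Lemma green_sum_harmonic x :
  limn (K ^~ x) = phi x + \int[P]_w limn (K ^~ (x + w 0)).
Proof.
have [C hC] := Kb.
have mz : measurable_fun [set: path] (fun w : path => x + w 0).
  by apply: measurable_latticeD => //; exact: measurable_coord.
have mK n : measurable_fun [set: path] (EFin \o fun w : path => K n (x + w 0)).
  exact: (measurableT_comp (measurable_lattice_fun (fun y => (K n y)%:E)) mz).
have mL : measurable_fun [set: path] (EFin \o fun w : path => limn (K ^~ (x + w 0))).
  exact: (measurableT_comp (measurable_lattice_fun (fun y => (limn (K ^~ y))%:E)) mz).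
have cv : {ae P, forall w, [set: path] w ->
    (fun n => (K n (x + w 0))%:E) @ \oo --> (limn (K ^~ (x + w 0)))%:E}.
  by apply/aeW => w _; apply: cvg_EFin; [exact: nearW|exact: cK].
have iC : P.-integrable [set: path] (EFin \o cst C).
  exact: (bounded_rv_integrableP P (bounded_rv_cst _ C)).
have dom : {ae P, forall w, forall n, [set: path] w ->
    (`|(K n (x + w 0))%:E| <= (EFin \o cst C) w)%E}.
  by apply/aeW => w n _; rewrite abse_EFin lee_fin; exact: hC.
have [iL _ cI] := dominated_convergence measurableT mK mL cv iC dom.
have cE : (fun n => \int[P]_w K n (x + w 0)) @ \oo -->
    \int[P]_w limn (K ^~ (x + w 0)).
  by apply: (fine_cvg); rewrite /Rintegral fineK ?(integrable_fin_num measurableT iL).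
apply: cvg_lim => //.
rewrite -cvg_shiftS /=; under eq_fun do rewrite KS.
by apply: cvgD; [exact: cvg_cst|].
Qed.

(** The multiples of [p] are pairwise distinct, as some coordinate of [p] is nonzero, and [phi]
    would take the value [phi 0 > 0] at all of them. *)
Lemma summable_not_periodic (p : lattice d) : p != 0 ->
  ~ (forall x, phi (x + p) = phi x).
Proof.
move=> p0 per.
have phip i : phi (p *+ i) = phi 0.
  by elim: i => [|i IH]; rewrite ?mulr0n // mulrSr per.
have inj : set_inj [set: nat] (fun i => p *+ i).
  move=> i j _ _ /= /eqP.
  have [k pk] : exists k, p 0 k != 0.
    apply: contrapT => h; move/negP: p0; apply; apply/eqP/matrixP => a k.
    rewrite (ord1 a) mxE; apply/eqP/negPn/negP => hk.
    by apply: h; exists k.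
  move/eqP/matrixP => /(_ 0 k); rewrite !mulmxnE.
  by move=> /(mulrIn pk).
have := hphi; set S := (\esum_(l in _) _)%E => hS.
have leS : (\sum_(0 <= i <oo) (phi 0)%:E <= S)%E.
  rewrite (_ : \sum_(0 <= i <oo) _ =
    \esum_(l in [set (p *+ i)%R | i in [set: nat]]) `|phi l|%:E)%E; last first.
    rewrite esum_image // -nneseries_esumT => [|n]; last by rewrite lee_fin.
    by apply: eq_eseriesr => i _; rewrite phip gtr0_norm.
  by rewrite esum_mkcond; apply: le_esum => l _; case: ifP; rewrite // lee_fin.
have fS : S \is a fin_num.
  by rewrite ge0_fin_numE //; apply: esum_ge0 => l _; rewrite lee_fin.
have bd (n : nat) : n%:R * phi 0 <= fine S.
  rewrite -lee_fin fineK //; apply: le_trans leS.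
  rewrite (_ : _%:E = \sum_(0 <= i < n) (phi 0)%:E)%E.
    by apply: nneseries_lim_ge => i _ _; rewrite lee_fin ltW.
  by rewrite sumEFin big_mkord sumr_const card_ord mulr_natl.
have := archi_boundP (normr_ge0 (fine S / phi 0)).
rewrite ltNge => /negP; apply.
apply: le_trans (ler_norm _); rewrite ler_pdivlMr //; exact: bd.
Qed.

Lemma variance_neq0 (s : R) :
  (fun n => \sum_(1 <= k < n) ker P phi k 0) @ \oo --> s -> phi 0 + 2 * s != 0.
Proof.
move=> cs; apply/eqP => v0.
(* Here only some point of positive mass is wanted; the next application provides a different
   one. *)
have [l _ ml] := second_point hnondet 0.
have [l' l'l ml'] := second_point hnondet l.
have per := green_sum_periodic ml ml' cs v0.
apply: (@summable_not_periodic (l - l')).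
  by rewrite subr_eq0 eq_sym.
move=> x; apply: (@addIr _ (\int[P]_w limn (K ^~ (x + w 0)))).
rewrite -(green_sum_harmonic x) -(per x) (green_sum_harmonic (x + (l - l'))).
apply: f_equal; apply: eq_Rintegral => w _.
by rewrite -(per (x + w 0)) addrAC.
Qed.

End nondegenerate.

(** * The skew product *)

Section skew.
Context (R : realType) (d : nat) dE (E : measurableType dE) (mu : probability E R).
Context (T : 'I_d -> automorphism mu).
Hypothesis Tcomm : forall i j x, T i (T j x) = T j (T i x).
Context (nu : probability (lattice d) R) (P : probability (path_space d) R).
Hypothesis hP : is_product_measure nu P.

Local Notation path := (path_space d).
Local Notation act := (lattice_action T).

Lemma iter_skew k (p : path * E) :
  iter k (skew_product T) p = (shiftn k p.1, act (walk k p.1) p.2).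
Proof.
elim: k => [|k IH].
  by rewrite /= shiftn0 walk0 lattice_action0; case: p.
rewrite iterS IH /skew_product /= -lattice_actionD //.
rewrite -[path_shift _]/(shiftn 1 _) shiftnD add1n; congr (_, act _ _).
by rewrite -[in RHS]addn1 walkD addrC; congr (_ + _); rewrite /walk big_ord1.
Qed.

Lemma measurable_action_pair dX (X : measurableType dX) dY
    (Y : measurableType dY) (z : X -> lattice d) (g : E -> Y) :
  measurable_fun [set: X] z -> measurable_fun [set: E] g ->
  measurable_fun [set: X * E] (fun p : X * E => g (act (z p.1) p.2)).
Proof.
move=> mz mg.
apply: (@measurable_lattice_case _ _ (X * E)%type _ _ (fun p : X * E => z p.1)
  (fun l p => g (act l p.2))).
  exact: (measurableT_comp mz measurable_fst).
move=> l; apply: (measurableT_comp mg).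
exact: (measurableT_comp (lattice_action_preserving T l).1 measurable_snd).
Qed.

(** Section by section: for fixed [w] the fibre map [T^(w 0)] preserves [mu], and what remains is
    invariance of [P] under the shift. *)
Lemma skew_preserving : preserving (P \x mu)%E (P \x mu)%E (skew_product T).
Proof.
have mS : measurable_fun [set: path * E] (skew_product T).
  apply: measurable_fun_pair.
    apply: (measurableT_comp _ measurable_fst).
    exact: (measurable_shiftn hP 1).
  exact: (measurable_action_pair (@measurable_coord d 0) (@measurable_id _ E setT)).
split => // A mA.
have mSA : measurable (skew_product T @^-1` A).
  by rewrite -[X in measurable X]setTI; exact: mS.
have mx : measurable_fun [set: path] (mu \o xsection A).
  exact: measurable_fun_xsection.
transitivity (\int[P]_w (mu \o xsection A) (shiftn 1 w))%E; last first.
  by rewrite (preserving_ge0_integral (shiftn_preserving hP 1) mx).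
apply: eq_integral => w _ /=.
rewrite -((lattice_action_preserving T (w 0)).2 _ (measurable_xsection _ mA)).
by congr (mu _); apply/seteqP; split => x; rewrite /xsection /= !inE.
Qed.

Variable f : E -> R.
Hypothesis hf : f \in Lfun mu 2%:E.

Local Notation a := (correlation T f).

Let mf : measurable_fun [set: E] f.
Proof. by move: hf; rewrite inE => /andP[]; rewrite inE /=. Qed.

Lemma normalized_variance_walk (w : path) n :
  normalized_variance mu (fun k x => f (act (walk k w) x)) n =
  (n%:R^-1 * \sum_(i < n) \sum_(j < n) a (walk i w - walk j w))%:E.
Proof.
by rewrite /normalized_variance (Lnorm2_action Tcomm hf n (fun k => walk k w)).
Qed.

Hypothesis ba : bounded_on_lattice a.

Let S n (p : path * E) : R := \sum_(k < n) f (iter k (skew_product T) p).2.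

Let measurable_S n : measurable_fun [set: path * E] (S n).
Proof.
apply: measurable_sum => k.
have -> : (fun p : path * E => f (iter k (skew_product T) p).2) =
    (fun p => f (act (walk k p.1) p.2)).
  by apply/funext => p; rewrite iter_skew.
exact: (measurable_action_pair (@measurable_walk d k) mf).
Qed.

(** By Tonelli the annealed variance is the expectation of the quenched one. *)
Lemma normalized_variance_skew n :
  normalized_variance (P \x mu)%E
    (fun k (p : path * E) => f (iter k (skew_product T) p).2) n =
  (n%:R^-1 *
   \int[P]_w (\sum_(i < n) \sum_(j < n) a (walk i w - walk j w)))%:E.
Proof.
rewrite /normalized_variance Lnorm2_sqr EFinM; congr (_ * _)%E.
have mS2 : measurable_fun [set: path * E] (fun p => (S n p ^+ 2)%:E).
  by apply/measurable_EFinP; exact: measurable_funX.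
transitivity (\int[P]_w \int[mu]_x (S n (w, x) ^+ 2)%:E)%E.
  by rewrite -(fubini_tonelli1 _ mS2) // => p; rewrite lee_fin sqr_ge0.
have bX : bounded_rv
    (fun w : path => \sum_(i < n) \sum_(j < n) a (walk i w - walk j w)).
  apply: bounded_rv_sum => i; apply: bounded_rv_sum => j.
  apply: bounded_rv_lattice => //; apply: measurable_latticeD.
    exact: measurable_walk.
  exact: (measurableT_comp (measurable_lattice_fun -%R) (measurable_walk j)).
rewrite /Rintegral fineK; last first.
  exact: (integrable_fin_num measurableT (bounded_rv_integrableP P bX)).
apply: eq_integral => w _.
rewrite -(Lnorm2_action Tcomm hf n (fun k => walk k w)) Lnorm2_sqr.
by apply: eq_integral => x _; rewrite /S; under eq_bigr => k _ do rewrite iter_skew.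
Qed.

(** The sum telescopes to [H - H \o S^n] for the skew product [S], whose squared norm is at most
    four times that of [H], whatever [n]. *)
Lemma coboundary_variance_le :
  L2_coboundary (P \x mu)%E (skew_product T) (fun p => f p.2) ->
  exists C : R, forall n,
    (normalized_variance (P \x mu)%E
      (fun k (p : path * E) => f (iter k (skew_product T) p).2) n <= (n%:R^-1 * C)%:E)%E.
Proof.
move=> [H hH FH]; have iH := Lfun2_integrable_sqr hH.
have mH : measurable_fun [set: path * E] H.
  by move: hH; rewrite inE => /andP[]; rewrite inE /=.
pose C := \int[(P \x mu)%E]_p (H p ^+ 2).
have CE : (\int[(P \x mu)%E]_p (H p ^+ 2)%:E)%E = C%:E.
  by rewrite /C /Rintegral fineK //; exact: (integrable_fin_num measurableT iH).
exists (2 * C + 2 * C) => n; rewrite EFinM; apply: lee_pmul.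
- by rewrite lee_fin invr_ge0.
- by rewrite Lnorm2_sqr; apply: integral_ge0 => p _; rewrite lee_fin sqr_ge0.
- exact: lexx.
rewrite Lnorm2_sqr -/(S n _).
pose Sn := iter n (skew_product T).
have pSn : preserving (P \x mu)%E (P \x mu)%E Sn.
  exact: iter_preserving skew_preserving.
have aeS : {ae (P \x mu)%E, forall p, S n p = H p - H (Sn p)}.
  (* The coboundary equation holds only almost everywhere; invariance carries it to all iterates
     outside one null set. *)
  have : {ae (P \x mu)%E, forall p, forall k, f (iter k (skew_product T) p).2 =
      H (iter k (skew_product T) p) - H (iter k.+1 (skew_product T) p)}.
    apply: ae_foralln => k.
    have := preserving_ae (iter_preserving k skew_preserving) FH.
    by apply: filterS => p; rewrite iterS; apply.
  apply: filterS => p h; rewrite /S /Sn; elim: n {pSn Sn} => [|m IH].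
    by rewrite big_ord0 /= subrr.
  by rewrite big_ord_recr /= IH h addrA subrK.
have mSn := measurableT_comp mH pSn.1.
have sqE (g : path * E -> R) : measurable_fun [set: path * E] g ->
    measurable_fun [set: path * E] (fun p => (g p ^+ 2)%:E).
  by move=> mg; apply/measurable_EFinP; exact: measurable_funX.
rewrite (@ae_eq_integral _ _ _ _ _ (fun p => ((H p - H (Sn p)) ^+ 2)%:E)) //; last 3 first.
- exact: (sqE _ (@measurable_S n)).
- exact: (sqE _ (measurable_funB mH mSn)).
- by apply: filterS aeS => p h _; rewrite -h.
apply: (@le_trans _ _ (\int[(P \x mu)%E]_p
    (2%:E * (H p ^+ 2)%:E + 2%:E * (H (Sn p) ^+ 2)%:E))%E).
  apply: ge0_le_integral => //.
  - by move=> p _; rewrite lee_fin sqr_ge0.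
  - exact: (sqE _ (measurable_funB mH mSn)).
  - by apply: emeasurable_funD; apply: measurable_funeM;
      [exact: (sqE _ mH)|exact: (sqE _ mSn)].
  - move=> p _; rewrite -!EFinM -EFinD lee_fin.
    have := sqr_ge0 (H p + H (Sn p)); rewrite sqrrD sqrrB; lra.
rewrite ge0_integralD //; first last.
- by apply: measurable_funeM; exact: (sqE _ mSn).
- by move=> p _; rewrite -EFinM lee_fin mulr_ge0 // sqr_ge0.
- by apply: measurable_funeM; exact: (sqE _ mH).
- by move=> p _; rewrite -EFinM lee_fin mulr_ge0 // sqr_ge0.
rewrite !ge0_integralZl_EFin //; try by move=> p _; rewrite lee_fin sqr_ge0.
- rewrite (preserving_ge0_integral pSn (sqE _ mH)) ?CE -?EFinM -?EFinD //.
  by move=> p; rewrite lee_fin sqr_ge0.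
- exact: (sqE _ mSn).
- exact: (sqE _ mH).
Qed.

End skew.

Theorem mainTheorem6 (R : realType) (d : nat) (hd : (0 < d)%N)
    (dE : measure_display) (E : measurableType dE) (mu : probability E R)
    (T : 'I_d -> automorphism mu)
    (Tcomm : forall i j x, T i (T j x) = T j (T i x))
    (nu : probability (lattice d) R) (P : probability (path_space d) R)
    (hP : is_product_measure nu P)
    (htransient : transient P) (haperiodic : aperiodic nu)
    (hnondet : ~ deterministic P)
    (f : E -> R) (hf : f \in Lfun mu 2%:E)
    (hf0 : ~ (f = cst 0 %[ae mu]))
    (hsum : (\esum_(l in [set: lattice d]) `|correlation T f l|%:E < +oo)%E) :
  let quenched (w : path_space d) : nat -> \bar R :=
    normalized_variance mu (fun k x => f (lattice_action T (walk k w) x)) in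
  let F_f : path_space d * E -> R := fun p => f p.2 in
  let annealed : nat -> \bar R :=
    normalized_variance (P \x mu)%E (fun k (p : path_space d * E) => F_f (iter k (skew_product T) p)) in
  [/\ {ae P, forall w, exists2 v : R, v != 0 & quenched w @ \oo --> v%:E},
      exists s : R,
        let v : \bar R := ('N[mu]_2%:E[EFin \o f] ^+ 2 + (2 * s)%:E)%E in
        [/\ (fun n => \sum_(1 <= k < n) lattice_sum (fun l =>
               (fine (P [set w | walk k w = l]) * correlation T f l)%R))%E
              @ \oo --> s%:E,
            {ae P, forall w, quenched w @ \oo --> v} &
            annealed @ \oo --> v] &
      ~ L2_coboundary (P \x mu)%E (skew_product T) F_f].
Proof.
move=> quenched F_f annealed.
set a := correlation T f in hsum *.
have aN l : a (- l) = a l by exact: (correlationN Tcomm hf).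
have a_pos n (c : nat -> R) (z : nat -> lattice d) :
    0 <= \sum_(i < n) \sum_(j < n) c i * c j * a (z i - z j).
  exact: (variance_action_ge0 Tcomm hf).
have a0 : 0 < a 0 by exact: (correlation0_gt0 Tcomm hf hf0).
have [s cs] := is_cvg_ker_sum hP htransient hsum 0.
have v0 := variance_neq0 hP htransient hnondet hsum aN a_pos a0 cs.
have vE : ('N[mu]_2%:E[EFin \o f] ^+ 2 + (2 * s)%:E = (a 0 + 2 * s)%:E)%E.
  by rewrite (Lnorm2_correlation0 Tcomm hf) EFinD.
have qcvg : {ae P, forall w, quenched w @ \oo --> (a 0 + 2 * s)%:E}.
  apply: filterS (quenched_cvg hP htransient hsum aN cs) => w cw.
  rewrite (_ : quenched w = EFin \o (fun n => n%:R^-1 *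
    \sum_(i < n) \sum_(j < n) a (walk i w - walk j w))).
    by apply: cvg_EFin cw; exact: nearW.
  by apply/funext => n; exact: (normalized_variance_walk Tcomm hf).
have acvg : annealed @ \oo --> (a 0 + 2 * s)%:E.
  rewrite (_ : annealed = EFin \o (fun n => n%:R^-1 *
    \int[P]_w (\sum_(i < n) \sum_(j < n) a (walk i w - walk j w)))).
    apply: cvg_EFin; first exact: nearW.
    exact: (cvg_expectation_variance hP hsum aN cs).
  apply/funext => n.
  exact: (normalized_variance_skew Tcomm P hf (summable_bounded hsum)).
split.
- by apply: filterS qcvg => w cw; exists (a 0 + 2 * s).
- exists s => v; rewrite /v vE; split => //.
  rewrite (_ : (fun n => _) = EFin \o (fun n => \sum_(1 <= k < n) ker P a k 0)).
    by apply: cvg_EFin cs; exact: nearW.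
  apply/funext => n /=; rewrite -sumEFin; apply: eq_bigr => k _.
  exact: (lattice_sum_ker P hsum).
- move=> cob; have [C hC] := coboundary_variance_le Tcomm hP hf cob.
  have c0 : (fun n => (n%:R^-1 * C)%:E) @ \oo --> (0 : R)%:E.
    apply: cvg_EFin; first exact: nearW.
    rewrite -(mul0r C) -cvg_shiftS /=; apply: cvgMl; exact: cvg_harmonic.
  (* Squeezed between 0 and [C / n], the annealed variance would tend to 0, contrary to [v0]. *)
  have : (a 0 + 2 * s)%:E = 0%E :> \bar R.
    apply: (cvg_unique _ acvg) => //.
    apply: (squeeze_cvge (f := cst 0%E) _ _ c0); last exact: cvg_cst.
    apply: nearW => n; rewrite hC andbT mule_ge0 ?lee_fin ?invr_ge0 //.
    by rewrite Lnorm2_sqr integral_ge0 // => p _; rewrite lee_fin sqr_ge0.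
  by case=> /eqP; exact/negP.
Qed.
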